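(* Let $\mu$ be a nondegenerate probability measure on the braid group $B(3)$ such that $\mu(\sigma_i)\neq 0$ and $\mu(\sigma_i^{-1})\neq 0$ for $i=1,2$. Then the set $$S=\{\beta\in B(3): \exists n\in\mathbb{N},\ \exists i,j\in\{1,2\}\ \text{such that}\ \mathrm{sign}\big((\beta\sigma_i\beta^{-1}\sigma_j)^n\big)\neq 0\}$$ is transient for the right random $\mu$-walk.
   Context: $B(3)$ is the group of braids with $3$ strands, with standard generators $\sigma_1,\sigma_2$. For a braid $\gamma$, $\mathrm{sign}(\gamma)$ denotes the signature of the link $\hat\gamma$ obtained by closing $\gamma$, i.e. the signature of the symmetric bilinear form $V+{}^tV$, where $V$ is a Seifert matrix of $\hat\gamma$. Random walks. Probability measures are taken with finite support. The convolution of probability measures on a discrete group $G$ is $(\mu_1\star\mu_2)(g)=\sum_{h\in G}\mu_1(gh^{-1})\mu_2(h)$, and $\mu^{\star k}$ is the $k$-fold convolution of $\mu$ with itself. A probability measure $\mu$ on $G$ is nondegenerate if $\mathrm{supp}(\mu)$ generates $G$ as a semigroup. The right random $\mu$-walk is the Markov chain starting at the identity, whose probability of being in a subset $S\subset G$ at the $k$-th step is $\mu^{\star k}(S)$. A subset $S\subset G$ is transient for this walk if $\mu^{\star k}(S)\to 0$ as $k\to\infty$. *)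

(* Defs.v *)
From HB Require Import structures.
From mathcomp Require Import all_boot all_order all_algebra.
From mathcomp Require Import all_classical all_reals all_analysis.
Import Order.TTheory GRing.Theory Num.Theory.
Import numFieldNormedType.Exports.

Set Implicit Arguments.
Unset Strict Implicit.
Unset Printing Implicit Defensive.

Local Open Scope classical_set_scope.
Local Open Scope ring_scope.

(* The letter (i, true) is the generator sigma_(i+1), and (i, false) is its
   inverse: the indices 0, 1 : 'I_2 stand for the usual 1, 2. *)
Definition letter : Type := ('I_2 * bool)%type.
Definition word : Type := seq letter.

Definition letter_inv (l : letter) : letter := (l.1, ~~ l.2).
Definition word_inv (w : word) : word := rev (map letter_inv w).

(* Artin's presentation <s1, s2 | s1 s2 s1 = s2 s1 s2>. *)
Inductive braid_eq : word -> word -> Prop :=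
| braid_eq_refl w : braid_eq w w
| braid_eq_sym u v : braid_eq u v -> braid_eq v u
| braid_eq_trans u v w : braid_eq u v -> braid_eq v w -> braid_eq u w
| braid_eq_cancel u v l : braid_eq (u ++ [:: l; letter_inv l] ++ v) (u ++ v)
| braid_eq_artin u v :
    let a : letter := (0, true) in
    let b : letter := (1, true) in
    braid_eq (u ++ [:: a; b; a] ++ v) (u ++ [:: b; a; b] ++ v).

HB.instance Definition _ := Choice.on word.

Definition braid_eqb (u v : word) : bool := `[< braid_eq u v >].

Lemma braid_eqb_refl : reflexive braid_eqb.
Proof. by move=> w; apply/asboolP; apply: braid_eq_refl. Qed.

Lemma braid_eqb_sym : symmetric braid_eqb.
Proof.
by move=> u v; apply/asboolP/asboolP => h; apply: braid_eq_sym.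
Qed.

Lemma braid_eqb_trans : transitive braid_eqb.
Proof.
move=> v u w /asboolP huv /asboolP hvw.
by apply/asboolP; apply: braid_eq_trans hvw.
Qed.

Canonical braid_equiv :=
  EquivRel braid_eqb braid_eqb_refl braid_eqb_sym braid_eqb_trans.

Definition B3 : Type := {eq_quot braid_equiv}%qT.

HB.instance Definition _ := Choice.on B3.
HB.instance Definition _ := EqQuotient.on B3.

Definition braid_of_word (w : word) : B3 := (\pi_B3 w)%qT.
Definition word_of_braid (b : B3) : word := repr b.

Lemma word_of_braidK : cancel word_of_braid braid_of_word.
Proof. by move=> b; rewrite /braid_of_word /word_of_braid reprK. Qed.

Lemma braid_of_wordP (u v : word) :
  braid_of_word u = braid_of_word v <-> braid_eq u v.
Proof.
rewrite /braid_of_word; split => [/eqP|h].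
  by rewrite eqmodE => /asboolP.
by apply/eqP; rewrite eqmodE; apply/asboolP.
Qed.

Lemma braid_eq_catl (t u v : word) :
  braid_eq u v -> braid_eq (t ++ u) (t ++ v).
Proof.
elim=> [w|{}u {}v _ ih|{}u {}v w _ ih1 _ ih2|{}u {}v l|{}u {}v a b].
- exact: braid_eq_refl.
- exact: braid_eq_sym.
- exact: braid_eq_trans ih2.
- by rewrite !(catA t u); apply: braid_eq_cancel.
- by rewrite !(catA t u); apply: braid_eq_artin.
Qed.

Lemma braid_eq_catr (t u v : word) :
  braid_eq u v -> braid_eq (u ++ t) (v ++ t).
Proof.
elim=> [w|{}u {}v _ ih|{}u {}v w _ ih1 _ ih2|{}u {}v l|{}u {}v a b].
- exact: braid_eq_refl.
- exact: braid_eq_sym.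
- exact: braid_eq_trans ih2.
- by rewrite -!catA; apply: braid_eq_cancel.
- by rewrite -!catA; apply: braid_eq_artin.
Qed.

Lemma braid_eq_cat (u u' v v' : word) :
  braid_eq u u' -> braid_eq v v' -> braid_eq (u ++ v) (u' ++ v').
Proof.
move=> hu hv.
exact: braid_eq_trans (braid_eq_catr v hu) (braid_eq_catl u' hv).
Qed.

Lemma letter_invK : involutive letter_inv.
Proof. by case=> i e; rewrite /letter_inv /= negbK. Qed.

Lemma word_invK : involutive word_inv.
Proof.
move=> w; rewrite /word_inv map_rev revK -map_comp -[RHS]map_id.
by apply: eq_map => l /=; rewrite letter_invK.
Qed.

Lemma word_mulwV (w : word) : braid_eq (w ++ word_inv w) [::].
Proof.
elim: w => [|l w ih]; first exact: braid_eq_refl.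
rewrite /word_inv /= rev_cons -cats1 catA.
have /(braid_eq_catl [:: l]) h := braid_eq_catr [:: letter_inv l] ih.
exact: braid_eq_trans h (braid_eq_cancel [::] [::] l).
Qed.

Definition braid_one : B3 := braid_of_word [::].
Definition braid_mul (x y : B3) : B3 :=
  braid_of_word (word_of_braid x ++ word_of_braid y).
Definition braid_inv (x : B3) : B3 :=
  braid_of_word (word_inv (word_of_braid x)).

Lemma word_of_braid_pi (w : word) :
  braid_eq (word_of_braid (braid_of_word w)) w.
Proof. by apply/braid_of_wordP; rewrite word_of_braidK. Qed.

Lemma braid_mul_pi (u v : word) :
  braid_mul (braid_of_word u) (braid_of_word v) = braid_of_word (u ++ v).
Proof.
by apply/braid_of_wordP; apply: braid_eq_cat; apply: word_of_braid_pi.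
Qed.

Lemma braid_mulA : associative braid_mul.
Proof.
move=> x y z.
rewrite -(word_of_braidK x) -(word_of_braidK y) -(word_of_braidK z).
by rewrite !braid_mul_pi catA.
Qed.

Lemma braid_mul1 : left_id braid_one braid_mul.
Proof.
by move=> x; rewrite -(word_of_braidK x) braid_mul_pi.
Qed.

Lemma braid_mulr1 : right_id braid_one braid_mul.
Proof.
by move=> x; rewrite -(word_of_braidK x) braid_mul_pi cats0.
Qed.

Lemma braid_mulV : right_inverse braid_one braid_inv braid_mul.
Proof.
move=> x; rewrite -{1}(word_of_braidK x) braid_mul_pi.
by apply/braid_of_wordP; apply: word_mulwV.
Qed.

Lemma braid_mulVl : left_inverse braid_one braid_inv braid_mul.
Proof.
move=> x; rewrite -{2}(word_of_braidK x) braid_mul_pi.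
apply/braid_of_wordP; rewrite -{2}(word_invK (word_of_braid x)).
exact: word_mulwV.
Qed.

HB.instance Definition _ := isGroup.Build B3
  braid_mulA braid_mul1 braid_mulr1 braid_mulVl braid_mulV.

Definition sigma (i : 'I_2) : B3 := braid_of_word [:: (i, true)].

Lemma braid_of_word_cat (u v : word) :
  braid_of_word (u ++ v) = (braid_of_word u * braid_of_word v)%g.
Proof. by apply/esym; apply: braid_mul_pi. Qed.

Lemma sigma_artin (s1 := sigma 0) (s2 := sigma 1) :
  (s1 * s2 * s1 = s2 * s1 * s2)%g.
Proof.
have h := braid_eq_artin [::] [::].
by move/braid_of_wordP: h; rewrite /= /s1 /s2 /sigma -!braid_of_word_cat.
Qed.

(* The quadratic form of A is x |-> x A x^T on row vectors. *)
Definition posdef_on (F : realFieldType) (n : nat) (A W : 'M[F]_n) : Prop :=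
  forall x : 'rV[F]_n, (x <= W)%MS -> x != 0 -> 0 < (x *m A *m x^T) 0 0.

Definition pos_index (F : realFieldType) (n : nat) (A : 'M[F]_n) : nat :=
  \max_(k < n.+1 | `[< exists2 W : 'M[F]_n, \rank W = k & posdef_on A W >]) k.

Definition signature (F : realFieldType) (n : nat) (A : 'M[F]_n) : int :=
  (pos_index A)%:Z - (pos_index (- A))%:Z.

(* Seifert's algorithm on the closure of w gives the surface made of three
   parallel disks D_0, D_1, D_2, stacked from bottom to top with their normals
   pointing up and their boundaries turning counterclockwise, and of one
   half-twisted band for each letter of w: the k-th letter (i, e) is a band
   between D_i and D_(i+1), at the k-th angular position, with a crossing of
   sign + if e = true and - if e = false.

   A basis of the first homology is given by the loops (p, q), for p < q two
   consecutive bands between the same two disks: climb band p, turn in the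
   upper disk from p to q, go down band q, return in the lower disk.

   If some generator does not occur in w, the surface is disconnected;
   connecting it by tubes only adds null rows and columns to the Seifert
   matrix, which does not affect the signature. *)

Section Seifert.
Variable w : word.

Let letter0 : letter := (0, true).

Definition col (k : nat) : nat := (nth letter0 w k).1.
Definition crossing (k : nat) : int := if (nth letter0 w k).2 then 1 else -1.

Definition is_loop (x : nat * nat) : bool :=
  [&& (x.1 < x.2 < size w)%N, col x.1 == col x.2
    & all (fun r => col r != col x.1) (iota x.1.+1 (x.2 - x.1.+1)%N)].

Definition loops : seq (nat * nat) :=
  [seq x <- [seq (p, q) | p <- iota 0 (size w), q <- iota 0 (size w)]
  | is_loop x].

(* Linking number of the loop x with the loop y pushed off the surface in the
   positive normal direction. For two loops between different pairs of disks it
   vanishes when y is above x; when y is below x, it is nonzero exactly when the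
   ends of x and y alternate. *)
Definition linking (x y : nat * nat) : int :=
  if x == y then - ((crossing x.1 + crossing x.2) %/ 2)%Z
  else if col x.1 == col y.1 then
    if x.2 == y.1 then (if crossing x.2 == 1 then 0 else -1)
    else if y.2 == x.1 then (if crossing x.1 == 1 then 1 else 0)
    else 0
  else if col x.1 == (col y.1).+1 then
    if [&& x.1 < y.1, y.1 < x.2 & x.2 < y.2]%N then 1
    else if [&& y.1 < x.1, x.1 < y.2 & y.2 < x.2]%N then -1
    else 0
  else 0.

Definition seifert_matrix : 'M[int]_(size loops) :=
  \matrix_(i, j) linking (nth (0%N, 0%N) loops i) (nth (0%N, 0%N) loops j).

End Seifert.

(* An integral form diagonalizes over the rationals, so that its signature may
   be computed over rat instead of the reals. *)
Definition word_sign (w : word) : int :=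
  signature (map_mx intr (seifert_matrix w + (seifert_matrix w)^T) : 'M[rat]_ _).

(* The closures of two words representing the same braid are isotopic links, so
   the value does not depend on the choice of the word. *)
Definition sign (b : B3) : int := word_sign (word_of_braid b).

Section RandomWalk.
Variables (R : realType) (G : groupType).
Implicit Types (mu : G -> R) (S : set G).

Definition supp mu : set G := [set g | mu g != 0].

Definition measure_of mu S : R := \sum_(g \in S) mu g.

Definition fin_probability mu : Prop :=
  [/\ forall g, 0 <= mu g, finite_set (supp mu) & measure_of mu [set: G] = 1].

Definition convolution (mu1 mu2 : G -> R) (g : G) : R :=
  \sum_(h \in [set: G]) mu1 (g * h^-1)%g * mu2 h.

Definition convolution_pow mu (k : nat) : G -> R :=
  iter k (convolution mu) (fun g => (g == 1%g)%:R).

Definition subsemigroup (T : set G) : Prop :=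
  forall x y, T x -> T y -> T (x * y)%g.

Definition nondegenerate_prob mu : Prop :=
  smallest subsemigroup (supp mu) = [set: G].

Definition transient mu S : Prop :=
  measure_of (convolution_pow mu k) S @[k --> \oo] --> (0 : R).

End RandomWalk.

(* Main.v *)
Require Import Defs.
From HB Require Import structures.
From mathcomp Require Import all_boot all_order all_algebra.
From mathcomp Require Import all_classical all_reals all_analysis.
From mathcomp Require Import ring lra zify.
Import Order.TTheory GRing.Theory Num.Theory.
Import numFieldNormedType.Exports.

Set Implicit Arguments.
Unset Strict Implicit.
Unset Printing Implicit Defensive.

Local Open Scope classical_set_scope.
Local Open Scope ring_scope.

(** Write e_1, e_2 for the basis vectors of Z^2. Sending sigma_i to the
    transvection u |-> u + cross(e_i, u) e_i is the action of B(3) on Z^2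
    through SL_2(Z), and the theorem follows from two facts about it.

    If |cross(b e_i, e_j)| > 2, then every power of b s_i b^-1 s_j has
    signature 0. Let a band be a vector u of Z^2 with a sign eps. A sequence of
    bands carries the quadratic form
       - sum_k eps_k x_k^2 + sum_(j < k) x_j x_k cross(u_j, u_k)
    on the space of the closed x, those with sum_k x_k u_k = 0. When the bands
    are the letters of a word, closed vectors are the cycles of the Seifert
    surface and the form is the symmetrized Seifert form [word_signE]. Allowing
    all directions u makes Hurwitz moves available: exchanging two neighbours
    while twisting one by the transvection of the other is an isometry
    [hurwitz_embeds]. A pair of neighbours that are inverse to each other
    contributes a hyperbolic plane or a null line [sig_cancel]. Hence the
    signature only depends on the braid [sig_braid_eq], and a subword
    b s_i b^-1 may be replaced by the single band with direction b e_i
    [sig_conjugate]. What remains is the alternating sequence (u, e_j)^n, whose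
    form is, with a = cross(u, e_j) and X_k = x_0 + ... + x_k,
       2 a sum_k X_k y_k - sum_k x_k^2 - sum_k y_k^2.
    As x is the cyclic difference of X, sum_k x_k^2 <= 4 sum_k X_k^2; for
    |a| > 2 the coupling term dominates, and positive definite subspaces match
    negative definite ones [definite_alt_sign].

    So every braid b of the set has one of the four numbers cross(b e_i, e_j),
    the entries of its matrix up to sign, in [-2, 2], and it remains to see that
    the walk rarely visits such a set at large times. The chance f_k(x) that
    b_k e_i lies in the strip |cross(-, x)| <= 2 at time k satisfies a mean
    value property: f_(n+k)(x) is an average of values f_k(g^-1 x). Among these
    g^-1 x are n + 1 pairwise independent vectors, reached with a probability
    bounded below because both sigma_i and sigma_i^-1 are charged. Two strips
    in independent directions share at most 25 points, so if each point has
    small probability the n + 1 values of f_k sum to little more than 1. A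
    bound of f_k for all large k, if it exceeds 2 / (n + 1), is thus lowered by
    a fixed amount after n steps, and f_k tends to 0 uniformly
    [anticoncentration]. The same argument, applied to points in place of
    strips, shows that points have small probability. *)

(** * Quadratic forms of sequences of bands *)

Definition plane (R : Type) : Type := (R * R)%type.

(** The sign makes cross e_2 e_1 = 1, in agreement with the linking numbers of
    the Seifert matrix. *)
Definition cross (R : comNzRingType) (u v : plane R) : R := u.2 * v.1 - u.1 * v.2.

(** Direction and sign. The letters of a braid word are the bands whose
    direction is a basis vector; other directions stand for conjugates of the
    generators. *)
Definition band : Type := (plane int * bool)%type.

Definition band_inv (g : band) : band := (g.1, ~~ g.2).

Definition eps (R : comNzRingType) (e : bool) : R := if e then 1 else -1.

(** The symplectic transvection by which the braid g acts on the plane. *)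
Definition twist (g : band) (u : plane int) : plane int :=
  (u.1 + eps int g.2 * cross g.1 u * g.1.1,
   u.2 + eps int g.2 * cross g.1 u * g.1.2).

Section Energy.
Variable F : realFieldType.
Implicit Types (v : plane F) (s m : seq band) (x t : seq F) (g h : band).

Definition plane_of_int (u : plane int) : plane F := (u.1%:~R, u.2%:~R).

(** A sequence x of coefficients describes a polygonal path, with steps x_k u_k.
    Letting the path start at an arbitrary point v makes its energy a sum of
    local contributions, so that a change in the middle of a sequence can be
    checked on the modified segment alone. *)
Fixpoint endpoint v s x : plane F :=
  match s, x with
  | g :: s', t :: x' =>
    endpoint (v.1 + t * (plane_of_int g.1).1, v.2 + t * (plane_of_int g.1).2) s' x'
  | _, _ => v
  end.

Fixpoint energy v s x : F :=
  match s, x with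
  | g :: s', t :: x' =>
    - eps F g.2 * t ^+ 2 + t * cross v (plane_of_int g.1)
    + energy (v.1 + t * (plane_of_int g.1).1, v.2 + t * (plane_of_int g.1).2) s' x'
  | _, _ => 0
  end.

Lemma endpoint_cat v s1 s2 x1 x2 : size x1 = size s1 ->
  endpoint v (s1 ++ s2) (x1 ++ x2) = endpoint (endpoint v s1 x1) s2 x2.
Proof.
elim: s1 x1 v => [|g s1 ih] [|t x1] v //= [sz].
exact: ih.
Qed.

Lemma energy_cat v s1 s2 x1 x2 : size x1 = size s1 ->
  energy v (s1 ++ s2) (x1 ++ x2)
  = energy v s1 x1 + energy (endpoint v s1 x1) s2 x2.
Proof.
elim: s1 x1 v => [|g s1 ih] [|t x1] v //= => [_|[sz]]; first by rewrite add0r.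
by rewrite ih // !addrA.
Qed.

(** A k-dimensional family of coefficient sequences is encoded by the sequence
    of its coordinate functionals, which are column vectors. *)
Definition ev k (c : 'rV[F]_k) (f : 'cV[F]_k) : F := (c *m f) 0 0.

Lemma evD k (c : 'rV[F]_k) f1 f2 : ev c (f1 + f2) = ev c f1 + ev c f2.
Proof. by rewrite /ev mulmxDr mxE. Qed.

Lemma evN k (c : 'rV[F]_k) f : ev c (- f) = - ev c f.
Proof. by rewrite /ev mulmxN mxE. Qed.

Lemma evB k (c : 'rV[F]_k) f1 f2 : ev c (f1 - f2) = ev c f1 - ev c f2.
Proof. by rewrite evD evN. Qed.

Lemma evZ k (c : 'rV[F]_k) a f : ev c (a *: f) = a * ev c f.
Proof. by rewrite /ev -scalemxAr mxE. Qed.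

Lemma ev0 k (c : 'rV[F]_k) : ev c 0 = 0.
Proof. by rewrite /ev mulmx0 mxE. Qed.

Lemma ev_sum k (c : 'rV[F]_k) (I : Type) (r : seq I) (P : pred I)
    (f : I -> 'cV[F]_k) :
  ev c (\sum_(i <- r | P i) f i) = \sum_(i <- r | P i) ev c (f i).
Proof. by rewrite /ev mulmx_sumr summxE. Qed.

Definition evE := (evD, evN, evZ, ev0).

Definition evs k (c : 'rV[F]_k) (ws : seq 'cV[F]_k) : seq F := map (ev c) ws.

(** For tau = 1 (resp. -1): the form has a positive (resp. negative) definite
    subspace of dimension k. Injectivity of the family follows from
    definiteness. *)
Definition definite (tau : F) (k : nat) (s : seq band) : Prop :=
  exists2 ws : seq 'cV[F]_k, size ws = size s &
    forall c : 'rV[F]_k, endpoint (0, 0) s (evs c ws) = (0, 0)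
      /\ (c != 0 -> 0 < tau * energy (0, 0) s (evs c ws)).

Lemma definite0 tau s : definite tau 0%N s.
Proof.
exists (nseq (size s) 0); first by rewrite size_nseq.
move=> c; rewrite (thinmx0 c) eqxx; split=> //.
have -> : forall v, endpoint v s (evs (0 : 'rV_0) (nseq (size s) 0)) = v => //.
elim: (s) => //= g s' ih v.
by rewrite ev0 !mul0r !addr0 ih -surjective_pairing.
Qed.

Lemma definite_pullback tau k k' s (C : 'M[F]_(k', k)) : row_free C ->
  definite tau k s -> definite tau k' s.
Proof.
move=> freeC [ws sz defw]; exists [seq C *m f | f <- ws]; first by rewrite size_map.
move=> c; have -> : evs c [seq C *m f | f <- ws] = evs (c *m C) ws.
  by rewrite /evs -map_comp; apply: eq_map => f /=; rewrite /ev mulmxA.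
have [-> pos] := defw (c *m C); split=> // c0; apply: pos.
by apply: contraNneq c0 => /eqP; rewrite mulmx_free_eq0.
Qed.

Lemma definite_leq tau k k' s : (k' <= k)%N -> definite tau k s -> definite tau k' s.
Proof.
move=> lekk; apply: (@definite_pullback _ _ _ _ (pid_mx k')).
by rewrite /row_free rank_pid_mx //= eqxx.
Qed.

(** More than size s variables cannot be separated by size s functionals. *)
Lemma definite_bound tau k s : definite tau k s -> (k <= size s)%N.
Proof.
case=> ws sz defw; rewrite leqNgt; apply/negP => ltk.
pose W : 'M[F]_(k, size s) := \matrix_(i, j) (nth 0 ws j) i 0.
have /rowV0Pn[c /sub_kermxP cW c0] : kermx W != 0.
  by rewrite kermx_eq0 /row_free neq_ltn (leq_ltn_trans (rank_leq_col W) ltk).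
have [_ /(_ c0)] := defw c; suff -> : evs c ws = nseq (size s) 0.
  suff -> : forall v, energy v s (nseq (size s) 0) = 0 by rewrite mulr0 ltxx.
  elim: (s) => //= g s' ih v.
  by rewrite expr0n /= !mul0r mulr0 !addr0 ih addr0.
apply: (@eq_from_nth _ 0); first by rewrite size_map size_nseq.
move=> i; rewrite size_map => ilt; rewrite (nth_map 0) // nth_nseq -sz ilt.
rewrite /ev; have ilt' : (i < size s)%N by rewrite -sz.
have := congr1 (fun M : 'rV_(size s) => M 0 (Ordinal ilt')) cW.
rewrite !mxE => {2}<-; apply: eq_bigr => j _; rewrite !mxE /=.
by congr (_ * _).
Qed.


Definition inertia (tau : F) (s : seq band) : nat :=
  \max_(k < (size s).+1 | `[< definite tau k s >]) k.

Lemma definite_inertia tau s : definite tau (inertia tau s) s.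
Proof.
have : (0 < #|[pred k : 'I_(size s).+1 | `[< definite tau k s >]]|)%N.
  apply/card_gt0P; exists ord0; rewrite inE; exact: definite0.
case/(eq_bigmax_cond (fun k : 'I_(size s).+1 => nat_of_ord k)) => i.
by rewrite inE => di; rewrite /inertia => ->.
Qed.

Lemma inertia_ge tau k s : (k <= inertia tau s)%N <-> definite tau k s.
Proof.
split=> [lek|defk]; first exact: definite_leq lek (definite_inertia tau s).
have ltk : (k < (size s).+1)%N by rewrite ltnS; exact: definite_bound defk.
by apply: (@leq_bigmax_cond _ _ _ (Ordinal ltk)); apply/asboolP.
Qed.

Lemma inertia_shift tau d s s' :
  (forall k, definite tau (k + d)%N s <-> definite tau k s') ->
  definite tau d s -> inertia tau s = (inertia tau s' + d)%N.
Proof.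
move=> h dd; apply/eqP; rewrite eqn_leq; apply/andP; split; last first.
  by apply/inertia_ge/h/definite_inertia.
have /subnK <- : (d <= inertia tau s)%N by apply/inertia_ge.
rewrite leq_add2r; apply/inertia_ge/h; rewrite subnK; last by apply/inertia_ge.
exact: definite_inertia.
Qed.

Definition signature_of s : int := (inertia 1 s)%:Z - (inertia (-1) s)%:Z.

(** Signatures agree as soon as one form is, for the purpose of counting
    definite directions, the other one plus d hyperbolic planes. *)
Lemma sig_shift d s s' :
  (forall tau k, tau != 0 -> definite tau (k + d)%N s <-> definite tau k s') ->
  signature_of s = signature_of s'.
Proof.
move=> h; have dd tau : tau != 0 -> definite tau d s.
  by move=> t0; apply/(h tau 0%N t0)/definite0.
have n0 : (-1 : F) != 0 by rewrite oppr_eq0 oner_eq0.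
rewrite /signature_of (@inertia_shift 1 d s s') ?(@inertia_shift (-1) d s s')
  ?oner_eq0 //;
  try (by move=> k; apply: h; rewrite ?oner_eq0); last 2 first.
- exact: dd.
- by apply: dd; rewrite oner_eq0.
by rewrite !PoszD; ring.
Qed.

(** The segment m' carries, for every starting point, all that m carries: a
    family on m is turned into a family on m' with the same end point and the
    same energy. *)
Definition embeds m m' := forall k (ws : seq 'cV[F]_k), size ws = size m ->
  exists2 ws', size ws' = size m' & forall (c : 'rV[F]_k) v,
    endpoint v m' (evs c ws') = endpoint v m (evs c ws) /\
    energy v m' (evs c ws') = energy v m (evs c ws).

Lemma definite_embeds tau k s1 s2 m m' : embeds m m' ->
  definite tau k (s1 ++ m ++ s2) -> definite tau k (s1 ++ m' ++ s2).
Proof.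
move=> emb [ws sz defw].
have [w1 [wm [w2 [sz1 szm sz2 dw]]]] : exists w1 wm w2,
    [/\ size w1 = size s1, size wm = size m, size w2 = size s2
      & ws = w1 ++ wm ++ w2].
  rewrite !size_cat in sz.
  exists (take (size s1) ws), (take (size m) (drop (size s1) ws)),
    (drop (size m) (drop (size s1) ws)).
  by rewrite !cat_take_drop; split; rewrite // ?size_takel ?size_drop // sz; lia.
rewrite {}dw in defw; case: (emb _ wm szm) => wm' szm' wmE.
exists (w1 ++ wm' ++ w2); first by rewrite !size_cat sz1 szm' sz2.
move=> c; have [] := defw c.
rewrite /evs !map_cat !endpoint_cat ?energy_cat ?size_map //.
by rewrite !(proj1 (wmE _ _)) !(proj2 (wmE _ _)).
Qed.

Lemma sig_embeds s1 s2 m m' : embeds m m' -> embeds m' m ->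
  signature_of (s1 ++ m ++ s2) = signature_of (s1 ++ m' ++ s2).
Proof.
move=> e e'; apply: (@sig_shift 0) => tau k _; rewrite addn0.
by split; exact: definite_embeds.
Qed.

(** The path x_1 g + x_2 h is also x_2 (twist g h) + (x_1 - a x_2) g, and for
    a = eps * cross g h the energies agree as well. *)
Lemma hurwitz_embeds g h :
  embeds [:: g; h] [:: (twist g h.1, h.2); g].
Proof.
move=> k [|f1 [|f2 [|]]] // _.
pose a : F := (eps int g.2 * cross g.1 h.1)%:~R.
exists [:: f2; f1 - a *: f2] => // c v /=; rewrite !evE.
move: (ev c f1) (ev c f2) => x1 x2; rewrite /a {a} /twist /cross /=.
case: g h => [[g1 g2] e] [[h1 h2] e'] /=; case: v => v1 v2 /=.
rewrite !(rmorphD, rmorphM, rmorphB) /=.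
by case: e; rewrite /eps /= ?rmorphN ?rmorph1; split;
  do ?[congr pair]; ring.
Qed.

Lemma hurwitz_embeds_inv g h :
  embeds [:: (twist g h.1, h.2); g] [:: g; h].
Proof.
move=> k [|f1 [|f2 [|]]] // _.
pose a : F := (eps int g.2 * cross g.1 h.1)%:~R.
exists [:: f2 + a *: f1; f1] => // c v /=; rewrite !evE.
move: (ev c f1) (ev c f2) => x1 x2; rewrite /a {a} /twist /cross /=.
case: g h => [[g1 g2] e] [[h1 h2] e'] /=; case: v => v1 v2 /=.
rewrite !(rmorphD, rmorphM, rmorphB) /=.
by case: e; rewrite /eps /= ?rmorphN ?rmorph1; split;
  do ?[congr pair]; ring.
Qed.

Definition axis (i : 'I_2) : plane int := if i == 0 then (1, 0) else (0, 1).

Definition gen (i : 'I_2) : band := (axis i, true).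

(** Both sides allow the total displacement (A, B) with one free parameter z,
    and both have energy - 2 (z - (A + B) / 2)^2 - (A^2 + B^2) / 2 when starting
    at the origin, where z is the last coefficient on the left and the first
    one on the right. *)
Lemma artin_embeds : embeds [:: gen 0; gen 1; gen 0] [:: gen 1; gen 0; gen 1].
Proof.
move=> k [|f0 [|f1 [|f2 [|]]]] // _.
exists [:: f2; f0 + f2; f1 - f2] => // c v /=; rewrite !evE.
move: (ev c f0) (ev c f1) (ev c f2) => x0 x1 x2.
rewrite /cross /axis /= /eps; case: v => v1 v2 /=.
by split; do ?[congr pair]; ring.
Qed.

Lemma artin_embeds_inv :
  embeds [:: gen 1; gen 0; gen 1] [:: gen 0; gen 1; gen 0].
Proof.
move=> k [|f0 [|f1 [|f2 [|]]]] // _.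
exists [:: f1 - f0; f0 + f2; f0] => // c v /=; rewrite !evE.
move: (ev c f0) (ev c f1) (ev c f2) => x0 x1 x2.
rewrite /cross /axis /= /eps; case: v => v1 v2 /=.
by split; do ?[congr pair]; ring.
Qed.

End Energy.

(** * Cancelling pairs of bands *)
Section Insertion.
Variable F : realFieldType.
Implicit Types (v : plane F) (s m : seq band) (x t : seq F) (g h : band).

(** One coordinate, selected by p, of the displacement along a path. *)
Definition drift (p : plane F -> F) s x : F :=
  \sum_(y <- zip s x) y.2 * p (plane_of_int F y.1.1).

Lemma endpointE v s x :
  endpoint v s x = (v.1 + drift fst s x, v.2 + drift snd s x).
Proof.
rewrite /drift; elim: s x v => [|g s ih] [|t x] v /=;
  rewrite ?big_nil ?addr0 -?surjective_pairing //.
by rewrite ih !big_cons /= !addrA.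
Qed.

Lemma drift_cat p s1 s2 x1 x2 : size x1 = size s1 ->
  drift p (s1 ++ s2) (x1 ++ x2) = drift p s1 x1 + drift p s2 x2.
Proof. by move=> sz; rewrite /drift zip_cat // big_cat. Qed.

Lemma closed_driftP s x :
  endpoint (0, 0) s x = (0, 0) <-> drift fst s x = 0 /\ drift snd s x = 0.
Proof. by rewrite endpointE /= !add0r; split=> [[-> ->]|[-> ->]]. Qed.

Lemma drift_lin p s x t z : size x = size s -> size t = size s ->
  drift p s [seq y.1 + z * y.2 | y <- zip x t] = drift p s x + z * drift p s t.
Proof.
rewrite /drift; elim: s x t => [|g s ih] [|a x] [|b t] //=;
  rewrite ?big_nil ?mulr0 ?addr0 //.
by move=> [sx] [st]; rewrite !big_cons /= ih //; ring.
Qed.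

(** Adding a parameter z along a fixed sequence t makes the energy a quadratic
    polynomial in z, whose linear coefficient is a functional of the family
    parameter c. Only the existence of l and r matters: [definite_insert]
    compensates them, whatever they are. *)
Lemma energy_quadratic k s (ws : seq 'cV[F]_k) t (V1 V2 : 'cV[F]_k) (a : plane F) :
  size ws = size s -> size t = size s ->
  exists l (r : F), forall (c : 'rV[F]_k) z,
    energy (ev c V1 + z * a.1, ev c V2 + z * a.2) s
      [seq y.1 + z * y.2 | y <- zip (evs c ws) t]
    = energy (ev c V1, ev c V2) s (evs c ws) + z * ev c l + z ^+ 2 * r.
Proof.
elim: s ws t V1 V2 a => [|g s ih] [|f ws] [|b t] // V1 V2 a.
  by move=> _ _; exists 0, 0 => c z /=; rewrite ev0; ring.
move=> [sw] [st]; pose u := plane_of_int F g.1.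
have [l [r lrE]] := ih ws t (V1 + u.1 *: f) (V2 + u.2 *: f)
   (a.1 + b * u.1, a.2 + b * u.2) sw st.
exists (l - (2 * eps F g.2 * b) *: f + (cross a u) *: f
        + b *: (u.1 *: V2 - u.2 *: V1)).
exists (r - eps F g.2 * b ^+ 2 + b * cross a u) => c z /=.
have := lrE c z; rewrite /= !evE -/u.
have -> : ev c V1 + u.1 * ev c f + z * (a.1 + b * u.1)
  = ev c V1 + z * a.1 + (ev c f + z * b) * u.1 by ring.
have -> : ev c V2 + u.2 * ev c f + z * (a.2 + b * u.2)
  = ev c V2 + z * a.2 + (ev c f + z * b) * u.2 by ring.
move=> ->; rewrite [u.1 * ev c f]mulrC [u.2 * ev c f]mulrC.
by rewrite /cross /=; ring.
Qed.

Lemma eps_sqr e : eps F e * eps F e = 1.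
Proof. by case: e; rewrite /eps ?mulrNN mulr1. Qed.

Lemma epsN e : eps F (~~ e) = - eps F e.
Proof. by case: e; rewrite /eps ?opprK. Qed.

(** On a pair g, g^-1 with coefficients z + y and - y the displacement is that
    of z alone, whereas the energy has the additional term - 2 eps z y: the
    isotropic vector (1, -1) pairs with the coefficient z only. *)
Lemma cancel_step v g z y :
  endpoint v [:: g; band_inv g] [:: z + y; - y] = endpoint v [:: g] [:: z] /\
  energy v [:: g; band_inv g] [:: z + y; - y]
  = energy v [:: g] [:: z] - 2 * eps F g.2 * z * y.
Proof.
rewrite /= epsN /cross /=; split; first by congr pair; ring.
ring.
Qed.

Lemma cancel_energy v s1 s2 g x1 x2 z y : size x1 = size s1 ->
  endpoint v (s1 ++ [:: g; band_inv g] ++ s2) (x1 ++ [:: z + y; - y] ++ x2)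
  = endpoint v (s1 ++ [:: g] ++ s2) (x1 ++ [:: z] ++ x2) /\
  energy v (s1 ++ [:: g; band_inv g] ++ s2) (x1 ++ [:: z + y; - y] ++ x2)
  = energy v (s1 ++ [:: g] ++ s2) (x1 ++ [:: z] ++ x2) - 2 * eps F g.2 * z * y.
Proof.
move=> sz; do 2!rewrite (endpoint_cat _ _ _ sz) (energy_cat _ _ _ sz).
move: (endpoint v s1 x1) => w.
have sz1 : size [:: z] = size [:: g] by [].
have sz2 : size [:: z + y; - y] = size [:: g; band_inv g] by [].
rewrite (endpoint_cat _ _ _ sz1) (energy_cat _ _ _ sz1).
rewrite (endpoint_cat _ _ _ sz2) (energy_cat _ _ _ sz2).
have [-> ->] := cancel_step w g z y.
by split=> //; rewrite !addrA addrAC.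
Qed.

Definition lift_fun k (b : F) (f : 'cV[F]_k) : 'cV[F]_(1 + k) :=
  col_mx (b%:M) f.

Lemma ev_lift k (c : 'rV[F]_(1 + k)) b f :
  ev c (lift_fun b f) = c 0 0 * b + ev (rsubmx c) f.
Proof.
rewrite /ev /lift_fun -{1}[c]hsubmxK mul_row_col mxE; congr (_ + _).
rewrite mul_mx_scalar !mxE mulrC; congr (c _ _ * _); exact/val_inj.
Qed.

Definition reachable (w : plane F) s :=
  exists2 t, size t = size s & endpoint (0, 0) s t = w.

(** If the other bands can compensate a displacement by g, the pair g, g^-1
    brings a new variable z with coefficient z on g and compensation - z t
    elsewhere. The free coefficient y of the isotropic direction is adjusted so
    that the additional energy is exactly tau z^2, cross terms included. *)
Lemma definite_insert (tau : F) k s1 s2 g : tau != 0 ->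
  reachable (plane_of_int F g.1) (s1 ++ s2) ->
  definite tau k (s1 ++ s2) ->
  definite tau (1 + k)%N (s1 ++ [:: g; band_inv g] ++ s2).
Proof.
move=> tau0 [ts szt tE] [ws sz defw].
have [w1 [w2 [sz1 sz2 dw]]] : exists w1 w2,
    [/\ size w1 = size s1, size w2 = size s2 & ws = w1 ++ w2].
  exists (take (size s1) ws), (drop (size s1) ws).
  by rewrite cat_take_drop size_drop size_takel sz size_cat ?addKn ?leq_addr.
have [t1 [t2 [st1 st2 dt]]] : exists t1 t2,
    [/\ size t1 = size s1, size t2 = size s2 & ts = t1 ++ t2].
  exists (take (size s1) ts), (drop (size s1) ts).
  by rewrite cat_take_drop size_drop size_takel szt size_cat ?addKn ?leq_addr.
rewrite {}dw in defw; rewrite {}dt in tE.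
pose e := eps F g.2.
pose N := map (@GRing.opp F).
have [||l [r lrE]] := @energy_quadratic k (s1 ++ [:: g] ++ s2)
  (w1 ++ [:: 0] ++ w2) (N t1 ++ [:: 1] ++ N t2) 0 0 (0, 0).
- by rewrite !size_cat sz1 sz2.
- by rewrite !size_cat !size_map st1 st2.
(* The value of y for which - 2 e z y turns z l + z^2 r into tau z^2. *)
pose y := lift_fun (e / 2 * (r - tau)) ((e / 2) *: l).
pose L (ws : seq 'cV[F]_k) (ts : seq F) : seq 'cV[F]_(1 + k) :=
  [seq lift_fun p.2 p.1 | p <- zip ws (N ts)].
have szL (ws' : seq 'cV[F]_k) ts' : size ws' = size ts' -> size (L ws' ts') = size ws'.
  by move=> h; rewrite /L size_map size1_zip // size_map h.
exists (L w1 t1 ++ [:: lift_fun 1 0 + y; - y] ++ L w2 t2).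
  by rewrite !size_cat !szL ?sz1 ?sz2 ?st1 ?st2.
move=> c; set z := c 0 0; set c' := rsubmx c.
have evL (ws' : seq 'cV[F]_k) ts' : evs c (L ws' ts')
    = [seq p.1 + z * p.2 | p <- zip (evs c' ws') (N ts')].
  rewrite /evs /L; elim: ws' ts' => [|w ws' ih] [|b ts'] //=.
  by rewrite ih ev_lift addrC.
have evL1 : ev c (lift_fun 1 0) = z by rewrite ev_lift ev0 mulr1 addr0.
have [clos pos] := defw c'.
have eq1 v : energy v [:: g] [:: 0] = 0 by rewrite /= expr0n /=; ring.
have eq2 v : endpoint v [:: g] [:: 0] = v.
  by case: v => v1 v2 /=; rewrite !mul0r !addr0.
have szx1 : size [seq p.1 + z * p.2 | p <- zip (evs c' w1) (N t1)] = size s1.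
  by rewrite size_map size1_zip size_map ?sz1 // size_map st1.
have xE : [seq p.1 + z * p.2 | p <- zip (evs c' w1) (N t1)] ++ [:: z] ++
    [seq p.1 + z * p.2 | p <- zip (evs c' w2) (N t2)]
  = [seq p.1 + z * p.2 | p <- zip (evs c' (w1 ++ [:: 0] ++ w2))
      (N t1 ++ [:: 1] ++ N t2)].
  rewrite /evs !map_cat !zip_cat ?size_map ?sz1 ?st1 //= map_cat /=.
  by rewrite ev0 mulr1 add0r.
set x1 := map _ (zip (evs c' w1) _) in szx1 xE *.
set x2 := map _ (zip (evs c' w2) _) in xE *.
have [endE enE] : endpoint (0, 0) (s1 ++ [:: g; band_inv g] ++ s2)
      (evs c (L w1 t1 ++ [:: lift_fun 1 0 + y; - y] ++ L w2 t2))
    = endpoint (0, 0) (s1 ++ [:: g] ++ s2) (x1 ++ [:: z] ++ x2) /\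
  energy (0, 0) (s1 ++ [:: g; band_inv g] ++ s2)
      (evs c (L w1 t1 ++ [:: lift_fun 1 0 + y; - y] ++ L w2 t2))
    = energy (0, 0) (s1 ++ [:: g] ++ s2) (x1 ++ [:: z] ++ x2)
      - 2 * e * z * ev c y.
  rewrite /evs !map_cat -!/(evs _ _) !evL -/x1 -/x2 [evs _ [:: _; _]]/=.
  rewrite evD evN evL1.
  exact: cancel_energy.
have endx : endpoint (0, 0) (s1 ++ [:: g] ++ s2) (x1 ++ [:: z] ++ x2) = (0, 0).
  rewrite xE; apply/closed_driftP.
  have /closed_driftP[cl1 cl2] := clos.
  move: tE; rewrite endpointE /= !add0r => -[te1 te2].
  have dN p s x : drift p s (N x) = - drift p s x.
    rewrite /drift /N; elim: s x => [|h s ih] [|b x] /=; rewrite ?big_nil ?oppr0 //.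
    by rewrite !big_cons /= ih; ring.
  have d1 p b : drift p [:: g] [:: b] = b * p (plane_of_int F g.1).
    by rewrite /drift /= big_seq1.
  have D p : drift p (s1 ++ s2) (evs c' (w1 ++ w2)) = 0 ->
      drift p (s1 ++ s2) (t1 ++ t2) = p (plane_of_int F g.1) ->
      drift p (s1 ++ [:: g] ++ s2) [seq p0.1 + z * p0.2
        | p0 <- zip (evs c' (w1 ++ [:: 0] ++ w2)) (N t1 ++ [:: 1] ++ N t2)] = 0.
    rewrite /evs !map_cat /= ev0 -!/(evs _ _) => h1 h2.
    rewrite drift_lin ?size_cat /= ?size_map ?sz1 ?sz2 ?st1 ?st2 //.
    rewrite -[g :: s2]cat1s -[0 :: evs _ _]cat1s -[1 :: N t2]cat1s; move: h1 h2.
    rewrite !drift_cat ?size_map //  !dN !d1.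
    by move=> h1 h2; rewrite -h2 mul0r add0r h1 !mul1r; ring.
  by split; apply: D.
rewrite endE endx; split=> // c0.
have -> : energy (0, 0) (s1 ++ [:: g; band_inv g] ++ s2)
      (evs c (L w1 t1 ++ [:: lift_fun 1 0 + y; - y] ++ L w2 t2))
   = energy (0, 0) (s1 ++ s2) (evs c' (w1 ++ w2)) + tau * z ^+ 2.
  rewrite enE xE; have := lrE c' z; rewrite ev0 /= !mulr0 addr0 => ->.
  rewrite /y ev_lift evZ -/z -/c'.
  have -> : energy (0, 0) (s1 ++ [:: g] ++ s2) (evs c' (w1 ++ [:: 0] ++ w2))
    = energy (0, 0) (s1 ++ s2) (evs c' (w1 ++ w2)).
    rewrite /evs !map_cat /= ev0 -!/(evs _ _).
    rewrite -[g :: s2]cat1s -[0 :: evs _ _]cat1s.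
    by rewrite !energy_cat ?size_map // eq1 eq2 add0r.
  have e2 : e * e = 1 by exact: eps_sqr.
  have -> : 2 * e * z * (z * (e / 2 * (r - tau)) + e / 2 * ev c' l)
    = (e * e) * (z ^+ 2 * (r - tau) + z * ev c' l) by field.
  by rewrite e2; ring.
rewrite mulrDr mulrA -expr2.
have [c'0|c'n0] := eqVneq c' 0; last first.
  by rewrite ltr_wpDr ?pos // mulr_ge0 ?sqr_ge0.
rewrite ltr_wpDl //.
  rewrite c'0; suff -> : energy (0, 0) (s1 ++ s2) (evs (0 : 'rV_k) (w1 ++ w2)) = 0.
    by rewrite mulr0.
  have : energy (0, 0) (s1 ++ s2) (evs (0 : 'rV[F]_k) (w1 ++ w2)) = 0.
    move: (s1 ++ s2) (w1 ++ w2) => s w.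
    elim: s w => [|h s ih] [|f w] //=.
    have -> : ev (0 : 'rV[F]_k) f = 0 by rewrite /ev mul0mx mxE.
    by rewrite !mul0r !addr0 ih expr0n /= mulr0 !addr0.
  by [].
have z0 : z != 0.
  apply: contraNneq c0 => z0; rewrite -[c]hsubmxK -/c' c'0.
  rewrite [lsubmx c]mx11_scalar mxE.
  have -> : lshift k 0 = 0 :> 'I_(1 + k) by exact/val_inj.
  by rewrite -/z z0 raddf0 row_mx0.
by rewrite mulr_gt0 // exprn_even_gt0.
Qed.

End Insertion.

Section Deletion.
Variable F : realFieldType.
Implicit Types (v : plane F) (s m : seq band) (x t : seq F) (g h : band).

Lemma kernel_of_functional k (f : 'cV[F]_(1 + k)) :
  exists2 C : 'M[F]_(k, 1 + k), row_free C & C *m f = 0.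
Proof.
pose B := row_base (kermx f).
have rk : (k <= \rank (kermx f))%N.
  by have := rank_leq_col f; rewrite mxrank_ker; lia.
exists (pid_mx k *m B).
  by rewrite /row_free mxrankMfree ?row_base_free // rank_pid_mx.
apply/sub_kermxP/(submx_trans (submxMl _ _)).
by rewrite eq_row_base.
Qed.

Lemma split_family (T : Type) (s1 s2 : seq band) g h (ws : seq T) :
  size ws = size (s1 ++ [:: g; h] ++ s2) ->
  exists w1 w2 f1 f2, [/\ size w1 = size s1, size w2 = size s2
    & ws = w1 ++ [:: f1; f2] ++ w2].
Proof.
move=> sz; rewrite !size_cat /= in sz.
exists (take (size s1) ws).
have : size (drop (size s1) ws) = (size s2).+2 by rewrite size_drop sz; lia.
case: (drop _ ws) (cat_take_drop (size s1) ws) => [|f1 [|f2 w2]] // dw [sz2].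
by exists w2, f1, f2; rewrite size_takel ?dw //; lia.
Qed.

Lemma silent_pair v s1 s2 g x1 x2 b : size x1 = size s1 ->
  endpoint v (s1 ++ [:: g; band_inv g] ++ s2) (x1 ++ [:: b; - b] ++ x2)
  = endpoint v (s1 ++ s2) (x1 ++ x2) /\
  energy v (s1 ++ [:: g; band_inv g] ++ s2) (x1 ++ [:: b; - b] ++ x2)
  = energy v (s1 ++ s2) (x1 ++ x2).
Proof.
move=> sz; have := cancel_energy v s2 g x2 0 b sz; rewrite add0r => -[-> ->].
do 2!rewrite (endpoint_cat _ _ _ sz) (energy_cat _ _ _ sz) /=.
rewrite !mul0r expr0n /= !mulr0 !mul0r subr0 !add0r !addr0.
by rewrite -surjective_pairing.
Qed.

Lemma definite_silent_pair (tau : F) k (s1 s2 : seq band) g ws f :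
  size ws = size (s1 ++ s2) ->
  (forall c : 'rV[F]_k, endpoint (0, 0) (s1 ++ [:: g; band_inv g] ++ s2)
     (evs c (take (size s1) ws ++ [:: f; - f] ++ drop (size s1) ws)) = (0, 0) /\
   (c != 0 -> 0 < tau * energy (0, 0) (s1 ++ [:: g; band_inv g] ++ s2)
     (evs c (take (size s1) ws ++ [:: f; - f] ++ drop (size s1) ws)))) <->
  (forall c : 'rV[F]_k, endpoint (0, 0) (s1 ++ s2) (evs c ws) = (0, 0) /\
   (c != 0 -> 0 < tau * energy (0, 0) (s1 ++ s2) (evs c ws))).
Proof.
move=> sz.
have h (c : 'rV[F]_k) : evs c (take (size s1) ws ++ [:: f; - f] ++ drop (size s1) ws)
  = take (size s1) (evs c ws) ++ [:: ev c f; - ev c f] ++ drop (size s1) (evs c ws).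
  by rewrite /evs !map_cat /= evN map_take map_drop.
have sz' (c : 'rV[F]_k) : size (take (size s1) (evs c ws)) = size s1.
  by rewrite size_takel // size_map sz size_cat leq_addr.
split=> H c; have [] := H c; rewrite h;
  have [-> ->] := silent_pair (0, 0) s2 g (drop (size s1) (evs c ws)) (ev c f) (sz' c);
  by rewrite cat_take_drop.
Qed.

(** Conversely, restricting a family to the hyperplane where the coefficients of
    g and g^-1 are opposite costs one dimension, and there the pair is silent. *)
Lemma definite_delete (tau : F) k s1 s2 g :
  definite tau (1 + k)%N (s1 ++ [:: g; band_inv g] ++ s2) ->
  definite tau k (s1 ++ s2).
Proof.
case=> ws sz defw.
have [w1 [w2 [f1 [f2 [sz1 sz2 dw]]]]] := split_family sz.
have [C freeC Cf] := kernel_of_functional (f1 + f2).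
exists (map (mulmx C) (w1 ++ w2)); first by rewrite size_map !size_cat sz1 sz2.
apply/(@definite_silent_pair _ _ _ _ g _ (C *m f1)).
  by rewrite size_map !size_cat sz1 sz2.
move=> c.
have -> : take (size s1) [seq C *m i | i <- w1 ++ w2] ++ [:: C *m f1; - (C *m f1)]
     ++ drop (size s1) [seq C *m i | i <- w1 ++ w2] = map (mulmx C) ws.
  rewrite dw !map_cat -sz1 -(size_map (mulmx C) w1) take_size_cat // drop_size_cat //=.
  congr (_ ++ [:: _, _ & _]); apply/esym/eqP.
  by rewrite -addr_eq0 addrC -mulmxDr Cf.
have -> : evs c [seq C *m f | f <- ws] = evs (c *m C) ws.
  by rewrite /evs -map_comp; apply: eq_map => f /=; rewrite /ev mulmxA.
have [-> pos] := defw (c *m C); split=> // c0; apply: pos.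
by apply: contraNneq c0 => /eqP; rewrite mulmx_free_eq0.
Qed.

(** If the other bands cannot compensate g, the coefficients of g and g^-1 in a
    closed sequence are opposite, and the isotropic vector lies in the radical
    of the form. *)
Lemma definite_delete_unreachable (tau : F) k s1 s2 g :
  ~ reachable (plane_of_int F g.1) (s1 ++ s2) ->
  definite tau k (s1 ++ [:: g; band_inv g] ++ s2) <-> definite tau k (s1 ++ s2).
Proof.
move=> unr; split=> -[ws sz defw]; last first.
  exists (take (size s1) ws ++ [:: 0; - 0] ++ drop (size s1) ws).
    rewrite -[in RHS]cat1s -cat1s !size_cat /= addnCA -size_cat cat_take_drop.
    by rewrite sz size_cat /=; lia.
  exact/(@definite_silent_pair tau k s1 s2 g ws 0 sz).
have [w1 [w2 [f1 [f2 [sz1 sz2 dw]]]]] := split_family sz.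
have f12 : f2 = - f1.
  apply/eqP; rewrite -addr_eq0 addrC; apply/eqP/matrixP => i j.
  rewrite (ord1 j) [RHS]mxE; apply/eqP/negPn/negP => fi; apply: unr.
  pose c : 'rV[F]_k := delta_mx 0 i; pose b := (f1 + f2) i 0.
  have cE : ev c f1 + ev c f2 = b.
    by rewrite -evD /ev -rowE mxE.
  have [/closed_driftP[d1 d2] _] := defw c.
  (* This is - b^-1 times the values at c: the remaining bands displace by - b g. *)
  exists [seq y.1 + (- b^-1 - 1) * y.2 | y <- zip (evs c (w1 ++ w2)) (evs c (w1 ++ w2))].
    by rewrite size_map size1_zip size_map // !size_cat sz1 sz2.
  have D p : drift p (s1 ++ [:: g; band_inv g] ++ s2) (evs c ws) = 0 ->
     drift p (s1 ++ s2) (evs c (w1 ++ w2)) = - b * p (plane_of_int F g.1).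
    rewrite dw /evs !map_cat /= -cat1s -[ev c f1 :: _]cat1s.
    rewrite -[band_inv g :: _]cat1s -[ev c f2 :: _]cat1s.
    rewrite !drift_cat ?size_map // {2 3}/drift /= !big_seq1 /= -cE => h.
    by apply/eqP; rewrite -subr_eq0 -[X in _ == X]h; apply/eqP; ring.
  rewrite endpointE /= !add0r.
  rewrite !drift_lin ?size_map ?size_cat ?sz1 ?sz2 // (D _ d1) (D _ d2).
  have bb : b^-1 * b = 1 by rewrite mulVf.
  have E (u : F) : - b * u + (- b^-1 - 1) * (- b * u) = (b^-1 * b) * u by ring.
  by rewrite !E bb !mul1r.
exists (w1 ++ w2); first by rewrite !size_cat sz1 sz2.
apply/(@definite_silent_pair tau k s1 s2 g (w1 ++ w2) f1).
  by rewrite !size_cat sz1 sz2.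
by rewrite -sz1 take_size_cat // drop_size_cat // -f12 -dw.
Qed.

Lemma sig_cancel s1 s2 g :
  signature_of F (s1 ++ [:: g; band_inv g] ++ s2) = signature_of F (s1 ++ s2).
Proof.
have [re|unr] := pselect (reachable (plane_of_int F g.1) (s1 ++ s2)).
  apply: (@sig_shift F 1) => tau k tau0; rewrite addnC.
  by split; [exact: definite_delete|exact: definite_insert].
apply: (@sig_shift F 0) => tau k tau0; rewrite addn0.
exact: definite_delete_unreachable.
Qed.

End Deletion.

(** * Signatures of braid words *)

Definition band_of (l : letter) : band := (axis l.1, l.2).

Lemma band_of_inv l : band_of (letter_inv l) = band_inv (band_of l).
Proof. by []. Qed.

Section BraidWords.
Variable F : realFieldType.
Implicit Types (s : seq band) (g h : band).

Lemma sig_hurwitz s1 s2 g h :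
  signature_of F (s1 ++ [:: g; h] ++ s2)
  = signature_of F (s1 ++ [:: (twist g h.1, h.2); g] ++ s2).
Proof. apply: sig_embeds; [exact: hurwitz_embeds|exact: hurwitz_embeds_inv]. Qed.

Lemma sig_braid_eq (w w' : word) : braid_eq w w' ->
  signature_of F (map band_of w) = signature_of F (map band_of w').
Proof.
elim=> // {w w'} [u v w _ -> _ -> //|u v l|u v a b].
  rewrite !map_cat /= band_of_inv; exact: sig_cancel.
rewrite !map_cat; apply: sig_embeds; [exact: artin_embeds|exact: artin_embeds_inv].
Qed.

Definition act_word (w : word) (u : plane int) : plane int :=
  foldr (fun l => twist (band_of l)) u w.

(** Each letter of w is moved across the middle band by a Hurwitz move, and then
    meets its inverse. *)
Lemma sig_conjugate s1 s2 (w : word) h :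
  signature_of F (s1 ++ (map band_of w ++ [:: h] ++ map band_of (word_inv w)) ++ s2)
  = signature_of F (s1 ++ [:: (act_word w h.1, h.2)] ++ s2).
Proof.
elim: w s1 s2 => [|l w ih] s1 s2 /=; first by rewrite -surjective_pairing.
rewrite /word_inv /= rev_cons -/(word_inv w) map_rcons -cats1.
have := ih (s1 ++ [:: band_of l]) ([:: band_of (letter_inv l)] ++ s2).
rewrite -!catA /= -!catA /= => ->.
have := sig_hurwitz s1 ([:: band_of (letter_inv l)] ++ s2) (band_of l)
  (act_word w h.1, h.2).
rewrite /= => ->.
set g' := (twist _ _, _).
have := sig_cancel F (s1 ++ [:: g']) s2 (band_of l).
by rewrite -!catA /= band_of_inv.
Qed.

End BraidWords.

(** * Alternating sequences *)
Section Alternating.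
Variable F : realFieldType.
Implicit Types (g h : band) (a : F).

Definition repeat_word (T : Type) (n : nat) (m : seq T) : seq T :=
  flatten (nseq n m).

Lemma sig_repeat s1 m m' n :
  (forall s1 s2,
     signature_of F (s1 ++ m ++ s2) = signature_of F (s1 ++ m' ++ s2)) ->
  signature_of F (s1 ++ repeat_word n m) = signature_of F (s1 ++ repeat_word n m').
Proof.
move=> h; elim: n s1 => //= n ih s1.
by rewrite h -/(repeat_word n m) catA ih -catA.
Qed.

Lemma repeat_wordE (T : Type) n (m : seq T) :
  repeat_word n m = flatten (mkseq (fun=> m) n).
Proof. by congr flatten; elim: n => //= n ->; rewrite /mkseq /= (iotaDl 1 0) -map_comp. Qed.

Definition interleave (T : Type) n (x y : nat -> T) : seq T :=
  flatten (mkseq (fun k => [:: x k; y k]) n).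

Lemma size_interleave (T : Type) n (x y : nat -> T) : size (interleave n x y) = n.*2.
Proof.
elim: n => // n ih.
rewrite /interleave mkseqS flatten_rcons size_cat -/(interleave n x y) ih /=.
by rewrite addn2 doubleS.
Qed.

Lemma interleaveP (T : Type) (x0 : T) n (ws : seq T) : size ws = n.*2 ->
  ws = interleave n (fun k => nth x0 ws k.*2) (fun k => nth x0 ws k.*2.+1).
Proof.
elim: n ws => [|n ih] ws; first by case: ws.
elim/last_ind: ws => // ws b _; elim/last_ind: ws => // ws a _.
rewrite !size_rcons doubleS => -[sz].
rewrite /interleave mkseqS flatten_rcons.
rewrite !nth_rcons !size_rcons sz ltnS leqnn ltnn ltnS ltnn eqxx /= eqxx.
rewrite -!cats1 -catA; congr (_ ++ _).
rewrite {1}(ih _ sz) /interleave; congr flatten.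
apply/eq_in_map => k; rewrite mem_iota add0n => /andP[_ kn].
have k1 : (k.*2 < n.*2)%N by rewrite ltn_double.
have k2 : (k.*2.+1 < n.*2)%N by rewrite ltn_Sdouble.
by rewrite !nth_cat sz k1 k2.
Qed.

Definition psum (x : nat -> F) k : F := \sum_(j < k) x j.

Definition alt_form (a : F) n (x y : nat -> F) : F :=
  \sum_(k < n) (2 * a * psum x k.+1 * y k - x k ^+ 2 - y k ^+ 2).

(** In the coordinates X = psum x and Y = psum y of the path with respect to u
    and w, the coupling term X dY - Y dX differs from 2 X dY by the exact
    differential of X Y. *)
Lemma alt_energy (u w : plane int) n (x y : nat -> F)
    (s := repeat_word n [:: (u, true); (w, true)])
    (a := cross (plane_of_int F u) (plane_of_int F w)) :
  endpoint (0, 0) s (interleave n x y)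
  = (psum x n * u.1%:~R + psum y n * w.1%:~R,
     psum x n * u.2%:~R + psum y n * w.2%:~R)
  /\ energy (0, 0) s (interleave n x y)
     = alt_form a n x y - a * psum x n * psum y n.
Proof.
rewrite {}/s repeat_wordE; elim: n => [|n [ih1 ih2]].
  by rewrite /= /psum /alt_form !big_ord0 !mul0r !mulr0 subr0 addr0.
rewrite /interleave !mkseqS !flatten_rcons -/(interleave n x y).
have sz : size (interleave n x y)
    = size (flatten (mkseq (fun=> [:: (u, true); (w, true)]) n)).
  by rewrite !size_interleave.
rewrite (endpoint_cat _ _ _ sz) (energy_cat _ _ _ sz) ih1 ih2 /=.
rewrite /alt_form big_ord_recr /= /psum !big_ord_recr /= -!/(psum _ _).
rewrite /a /cross /= /eps; split; first by congr pair; ring.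
ring.
Qed.

Lemma definite_alt (tau : F) k n (u w : plane int)
    (a := cross (plane_of_int F u) (plane_of_int F w)) : a != 0 ->
  definite tau k (repeat_word n [:: (u, true); (w, true)]) <->
  exists x y : nat -> 'cV[F]_k, forall c,
    [/\ psum (ev c \o x) n = 0, psum (ev c \o y) n = 0
      & c != 0 -> 0 < tau * alt_form a n (ev c \o x) (ev c \o y)].
Proof.
move=> a0; have szr : size (repeat_word n [:: (u, true); (w, true)]) = n.*2.
  by rewrite repeat_wordE (size_interleave n (fun=> (u, true)) (fun=> (w, true))).
have evI (x y : nat -> 'cV[F]_k) c :
    evs c (interleave n x y) = interleave n (ev c \o x) (ev c \o y).
  by rewrite /evs /interleave map_flatten /mkseq -map_comp.
split=> [[ws sz]|[x [y xy]]]; last first.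
  exists (interleave n x y); first by rewrite size_interleave szr.
  move=> c; rewrite evI; have [-> ->] := alt_energy u w n (ev c \o x) (ev c \o y).
  by have [-> -> pos] := xy c; rewrite !mul0r mulr0 subr0 addr0; split.
rewrite szr in sz; rewrite (interleaveP 0 sz).
set x := fun k => _; set y := fun k => nth _ _ _.+1 => xy; exists x, y => c.
have := xy c; rewrite evI; have [-> ->] := alt_energy u w n (ev c \o x) (ev c \o y).
move: (psum _ n) (psum _ n) => Y X [[e1 e2]].
have Xa : X * a = w.1%:~R * (X * u.2%:~R + Y * w.2%:~R)
    - w.2%:~R * (X * u.1%:~R + Y * w.1%:~R) by rewrite /a /cross /=; ring.
have Ya : Y * a = u.2%:~R * (X * u.1%:~R + Y * w.1%:~R)
    - u.1%:~R * (X * u.2%:~R + Y * w.2%:~R) by rewrite /a /cross /=; ring.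
move: Xa Ya; rewrite e1 e2 !mulr0 subrr => /eqP + /eqP.
rewrite !mulf_eq0 (negPf a0) !orbF => /eqP X0 /eqP Y0.
by rewrite X0 Y0 !mulr0 subr0.
Qed.

Definition cyc_prev n (z : nat -> F) k : F := if k is k'.+1 then z k' else z n.-1.

Lemma sum_prev n (z : nat -> F) (f : F -> F) :
  \sum_(k < n) f (cyc_prev n z k) = \sum_(k < n) f (z k).
Proof.
case: n => [|n]; first by rewrite !big_ord0.
by rewrite big_ord_recl [RHS]big_ord_recr /= addrC.
Qed.

(** The cyclic difference operator has norm at most 2. *)
Lemma sum_diff_sqr n (z : nat -> F) :
  \sum_(k < n) (z k - cyc_prev n z k) ^+ 2 <= 4 * \sum_(k < n) z k ^+ 2.
Proof.
have -> : 4 * \sum_(k < n) z k ^+ 2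
  = \sum_(k < n) (2 * z k ^+ 2 + 2 * cyc_prev n z k ^+ 2).
  rewrite big_split /= -!mulr_sumr.
  by rewrite (sum_prev n z (fun t => t ^+ 2)); ring.
apply: ler_sum => k _; rewrite -subr_ge0.
suff -> : 2 * z k ^+ 2 + 2 * cyc_prev n z k ^+ 2 - (z k - cyc_prev n z k) ^+ 2
  = (z k + cyc_prev n z k) ^+ 2 by exact: sqr_ge0.
ring.
Qed.

Lemma psum_diff n (z : nat -> F) k :
  psum (fun j => z j - cyc_prev n z j) k.+1 = z k - z n.-1.
Proof.
elim: k => [|k ih]; first by rewrite /psum big_ord_recl big_ord0 addr0.
by rewrite /psum big_ord_recr /= -/(psum (fun j => z j - cyc_prev n z j) k.+1) ih; ring.
Qed.

Lemma alt_form_cyclic a n (z : nat -> F) : psum z n = 0 ->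
  alt_form a n (fun k => z k - cyc_prev n z k) (fun k => a * z k)
  = a ^+ 2 * (\sum_(k < n) z k ^+ 2) - \sum_(k < n) (z k - cyc_prev n z k) ^+ 2.
Proof.
move=> z0; rewrite /alt_form.
transitivity (a ^+ 2 * (\sum_(k < n) z k ^+ 2)
  - \sum_(k < n) (z k - cyc_prev n z k) ^+ 2 - 2 * a ^+ 2 * z n.-1 * psum z n).
  rewrite [psum z n]/psum !mulr_sumr -!sumrB; apply: eq_bigr => k _.
  by rewrite psum_diff; ring.
by rewrite z0 mulr0 subr0.
Qed.

(** For |a| > 2 the lower bound is positive unless z vanishes, so that the
    sequences with y = a X, where X has mean zero, form a positive subspace. *)
Lemma alt_form_cyclic_ge a n (z : nat -> F) : psum z n = 0 ->
  (a ^+ 2 - 4) * (\sum_(k < n) z k ^+ 2)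
  <= alt_form a n (fun k => z k - cyc_prev n z k) (fun k => a * z k).
Proof.
by move=> z0; rewrite alt_form_cyclic // mulrBl lerD2l lerN2 sum_diff_sqr.
Qed.

Lemma sum_sqr_gt0 n (z : nat -> F) : ~ (forall k, (k < n)%N -> z k = 0) ->
  0 < \sum_(k < n) z k ^+ 2.
Proof.
move=> nz; rewrite lt0r sumr_ge0 ?andbT; last by move=> k _; exact: sqr_ge0.
apply/negP; rewrite psumr_eq0 => [/allP h|k _]; last exact: sqr_ge0.
apply: nz => k kn; have := h (Ordinal kn) (mem_index_enum _).
by rewrite /= sqrf_eq0 => /eqP.
Qed.

Lemma alt_form_eq a n (x y x' y' : nat -> F) :
  (forall k, (k < n)%N -> x k = x' k) -> (forall k, (k < n)%N -> y k = y' k) ->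
  alt_form a n x y = alt_form a n x' y'.
Proof.
move=> hx hy; apply: eq_bigr => k _; rewrite hx // hy //.
congr (_ * _ * _ - _ - _); apply: eq_bigr => j _; apply: hx.
exact: leq_trans (ltn_ord j) (ltn_ord k).
Qed.

(** A positive subspace meets the negative one y = 0 trivially, so it embeds by
    its y-part into the sequences (x, 0), where the form is negative. A negative
    subspace meets the positive one of the sequences with y = a (X - mean X)
    trivially, so it embeds into the latter by z = y - a (X - mean X). *)
Lemma definite_alt_sign k n (u w : plane int)
    (s := repeat_word n [:: (u, true); (w, true)])
    (a := cross (plane_of_int F u) (plane_of_int F w)) : 4 < a ^+ 2 ->
  definite (1 : F) k s <-> definite (-1 : F) k s.
Proof.
move=> a4; have a0 : a != 0.
  by apply: contraTneq a4 => ->; rewrite expr0n /= -leNgt.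
case: (posnP n) => [n0|n0].
  rewrite /s n0 /repeat_word /=.
  by split=> /definite_bound; rewrite leqn0 => /eqP->; exact: definite0.
split=> /definite_alt => /(_ a0) [x [y xy]]; apply/definite_alt => //.
  exists y, (fun=> 0) => c; have [x0 y0 pos] := xy c; split=> //.
    by rewrite /psum big1 // => j _ /=; rewrite ev0.
  move=> c0; have {pos} := pos c0; rewrite mul1r mulN1r => pos.
  have -> : alt_form a n (ev c \o y) (ev c \o (fun=> 0)) = - \sum_(j < n) ev c (y j) ^+ 2.
    rewrite /alt_form -sumrN; apply: eq_bigr => j _ /=; rewrite ev0; ring.
  rewrite opprK; apply: (sum_sqr_gt0 (z := ev c \o y)) => h.
  move: pos; rewrite -/a (@alt_form_eq a n _ _ (ev c \o x) (fun=> 0)) //.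
  rewrite /alt_form ltNge => /negP; apply.
  apply: sumr_le0 => j _; rewrite mulr0 expr0n /= subr0 sub0r oppr_le0; exact: sqr_ge0.
pose X k := \sum_(j < k.+1) x j; pose m := n%:R^-1 *: \sum_(j < n) X j.
pose z k := y k - a *: (X k - m).
pose prevz k := if k is k'.+1 then z k' else z n.-1.
exists (fun k => z k - prevz k), (fun k => a *: z k) => c.
have [x0 y0 pos] := xy c.
have prevE j : ev c (prevz j) = cyc_prev n (ev c \o z) j by case: j.
pose Z k := ev c (X k - m).
have XE j : ev c (X j) = psum (ev c \o x) j.+1 by rewrite /X ev_sum.
have Z0 : psum Z n = 0.
  rewrite /psum /Z; under eq_bigr do rewrite evB.
  rewrite sumrB sumr_const card_ord /m evZ ev_sum -mulrnAl -[_^-1 *+ n]mulr_natl divff.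
    by rewrite mul1r subrr.
  by rewrite pnatr_eq0 -lt0n.
have z0 : psum (ev c \o z) n = 0.
  rewrite /psum; under eq_bigr do rewrite /= /z evB evZ -/(Z _).
  by rewrite sumrB -mulr_sumr -/(psum Z n) Z0 mulr0 subr0; exact: y0.
have a4' : 0 < a ^+ 2 - 4 by rewrite subr_gt0.
split.
- rewrite /psum; under eq_bigr do rewrite /= evB prevE.
  by rewrite sumrB (sum_prev n (ev c \o z) id) /= subrr.
- rewrite /psum; under eq_bigr do rewrite /= evZ.
  by rewrite -mulr_sumr -/(psum (ev c \o z) n) z0 mulr0.
move=> c0; have {pos} := pos c0; rewrite mul1r mulN1r oppr_gt0 => neg.
rewrite (@alt_form_eq a n _ _ (fun j => (ev c \o z) j - cyc_prev n (ev c \o z) j)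
  (fun j => a * (ev c \o z) j)); first last.
- by move=> j _ /=; rewrite evZ.
- by move=> j _ /=; rewrite evB prevE.
apply: lt_le_trans (alt_form_cyclic_ge a z0).
apply: mulr_gt0 => //; apply: sum_sqr_gt0 => h.
have yE j : (j < n)%N -> ev c (y j) = a * Z j.
  by move=> /h /=; rewrite /z evB evZ -/(Z _) => /eqP; rewrite subr_eq0 => /eqP.
have xE j : (j < n)%N -> ev c (x j) = Z j - cyc_prev n Z j.
  case: j => [_|j _] /=; rewrite /Z !evB !XE.
    rewrite prednK // x0 /psum big_ord_recl big_ord0 /=; ring.
  rewrite [psum _ j.+2]/psum big_ord_recr /= -/(psum (ev c \o x) j.+1); ring.
move: neg; rewrite -/a (@alt_form_eq a n _ _ (fun j => Z j - cyc_prev n Z j)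
  (fun j => a * Z j)) //.
rewrite ltNge => /negP; apply.
apply: le_trans (alt_form_cyclic_ge a Z0).
by rewrite mulr_ge0 ?(ltW a4') // sumr_ge0 // => j _; exact: sqr_ge0.
Qed.

Lemma sig_alt n (u w : plane int) : 2 < `|cross u w| ->
  signature_of F (repeat_word n [:: (u, true); (w, true)]) = 0.
Proof.
move=> uw; set s := repeat_word _ _.
have h : 4 < cross (plane_of_int F u) (plane_of_int F w) ^+ 2.
  have -> : cross (plane_of_int F u) (plane_of_int F w) ^+ 2 = (cross u w ^+ 2)%:~R.
    by rewrite /cross /= !(rmorphXn, rmorphB, rmorphM).
  by rewrite -[4]/(4%:~R) ltr_int -[_ ^+ 2]real_normK ?num_real //; nia.
have eqi := fun k => definite_alt_sign k n h.
rewrite /signature_of; apply/eqP; rewrite subr_eq0 eqz_nat eqn_leq.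
by apply/andP; split; apply/inertia_ge/eqi/definite_inertia.
Qed.

Lemma sig_word_power (b : word) (i j : 'I_2) n :
  2 < `|cross (act_word b (axis i)) (axis j)| ->
  signature_of F (map band_of
    (repeat_word n (b ++ [:: (i, true)] ++ word_inv b ++ [:: (j, true)]))) = 0.
Proof.
move=> hb; rewrite -(sig_alt n hb) /repeat_word map_flatten map_nseq.
apply: (@sig_repeat [::]) => s1 s2.
have := sig_conjugate F s1 ([:: gen j] ++ s2) b (gen i).
by rewrite !map_cat -!catA /= -?catA => ->.
Qed.

End Alternating.

(** * The Seifert form of a braid word *)
Section SeifertForm.
Variable w : word.

Let N := size w.

(** Upper triangular matrix of the energy of a braid word. *)
Definition gram (a b : nat) : int :=
  if a == b then - crossing w a
  else if (a < b)%N then (Defs.col w a)%:Z - (Defs.col w b)%:Z else 0.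

Definition gram_loop (x y : nat * nat) : int :=
  gram x.1 y.1 - gram x.1 y.2 - gram x.2 y.1 + gram x.2 y.2.

Lemma col_lt2 k : (Defs.col w k < 2)%N.
Proof. exact: ltn_ord. Qed.

Lemma is_loopP x : is_loop w x ->
  [/\ (x.1 < x.2)%N, (x.2 < N)%N, Defs.col w x.1 = Defs.col w x.2
    & forall r, (x.1 < r)%N -> (r < x.2)%N -> Defs.col w r <> Defs.col w x.1].
Proof.
case/and3P=> /andP[h1 h2] /eqP h3 /allP h4; split=> // r r1 r2.
by apply/eqP/h4; rewrite mem_iota; lia.
Qed.

(** The left-hand side is the polar form of the energy, while V + V^T is the
    matrix of the energy itself; hence the factor 2. For loops in different
    columns both sides tell, with a sign, whether their ends alternate. *)
Lemma linking_gram x y : is_loop w x -> is_loop w y ->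
  gram_loop x y + gram_loop y x = 2 * (linking w x y + linking w y x).
Proof.
case: x y => [p q] [p' q'] /is_loopP /= [pq qN cpq hpq] /is_loopP /= [pq' qN' cpq' hpq'].
rewrite /gram_loop /gram /linking /=.
have crE k : crossing w k = 1 \/ crossing w k = -1.
  by rewrite /crossing; case: ifP; [left|right].
have [[-> ->]|neq] := eqVneq (p, q) (p', q').
  rewrite !eqxx (ltn_eqF pq') (gtn_eqF pq') cpq' !subrr.
  rewrite !if_same.
  by case: (crE p') (crE q') => -> [->|->].
have {}neq : p != p' \/ q != q'.
  by apply/orP; rewrite -negb_and -xpair_eqE.
have e1 : p = p' -> q = q'.
  move=> e; subst p'; case: (ltngtP q q') => // h.
    by case: (hpq' q).
  by case: (hpq q').
have e2 : q = q' -> p = p'.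
  move=> e; subst q'; case: (ltngtP p p') => // h.
    by case: (hpq p') => //; rewrite cpq' cpq.
  by case: (hpq' p) => //; rewrite cpq cpq'.
have n1 : p != p' by apply/eqP => e; case: neq => /eqP; rewrite ?e // e1.
have n2 : q != q' by apply/eqP => e; case: neq => /eqP; rewrite ?e // e2.
rewrite (eq_sym p' p) (eq_sym q' q) (negPf n1) (negPf n2) /=.
have [cc|cc] := eqVneq (Defs.col w p) (Defs.col w p').
  rewrite -!cpq -!cpq' -!cc !subrr !if_same.
  rewrite ?(eq_sym q' p) ?(eq_sym p' q).
  have [e|ne] := eqVneq q p'; have [e'|ne'] := eqVneq p q'; try lia.
  - by rewrite -e; case: (crE q) => ->.
  - by rewrite -e'; case: (crE p) => ->.
have d1 : p != q' by apply: contraNneq cc => ->; rewrite cpq'.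
have d2 : q != p' by apply: contraNneq cc => <-; rewrite cpq.
rewrite (eq_sym q') (eq_sym p' q) (negPf d1) (negPf d2) -!cpq -!cpq'.
move: (col_lt2 p) (col_lt2 p') cc; move: (Defs.col w p) (Defs.col w p') => c c'.
case: c => [|[|]] //; case: c' => [|[|]] //= _ _ _;
 case: (ltngtP p p') n1 => // h1 _; case: (ltngtP p q') d1 => // h2 _;
 case: (ltngtP q p') d2 => // h3 _; case: (ltngtP q q') n2 => // h4 _ //=; exfalso; lia.
Qed.

Variable F : realFieldType.

(** For axis vectors, cross (axis i) (axis j) is i - j, and the two coordinates
    of the displacement are the sums over the two columns. *)
Lemma energy_gram (f : nat -> F) n : (n <= N)%N ->
  endpoint (0, 0) (mkseq (nth (gen 0) (map band_of w)) n) (mkseq f n)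
  = (\sum_(a < n | Defs.col w a == 0%N) f a, \sum_(a < n | Defs.col w a == 1%N) f a) /\
  energy (0, 0) (mkseq (nth (gen 0) (map band_of w)) n) (mkseq f n)
  = \sum_(a < n) f a * \sum_(b < n) f b * (gram a b)%:~R.
Proof.
elim: n => [_|n ih nN]; first by rewrite !big_ord0.
have [ih1 ih2] := ih (ltnW nN).
rewrite !mkseqS -!cats1; set s := mkseq _ n in ih1 ih2 *.
have sz : size (mkseq f n) = size s by rewrite !size_mkseq.
rewrite (endpoint_cat _ _ _ sz) (energy_cat _ _ _ sz) ih1 ih2 /=.
rewrite (nth_map (0, true)) // /band_of.
have cE k : Defs.col w k = (nth (0, true) w k).1 by [].
have epsE : eps F (nth (0, true) w n).2 = (crossing w n)%:~R.
  by rewrite /crossing /eps; case: ifP.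
set i := (nth _ w n).1; have ci : Defs.col w n = i by [].
split.
  have recr (P : pred nat) : \sum_(a < n.+1 | P a) f a
      = \sum_(a < n | P a) f a + (if P n then f n else 0).
    by rewrite big_mkcond big_ord_recr -big_mkcond.
  rewrite (recr (fun a => Defs.col w a == 0%N)) (recr (fun a => Defs.col w a == 1%N)) ci.
  by rewrite /axis; case: (i) => [[|[|]]] //= ?; rewrite ?mulr0 ?mulr1 ?addr0.
rewrite big_ord_recr /= [\sum_(b < n.+1) _]big_ord_recr /=.
have -> : \sum_(b < n) f b * (gram n b)%:~R = 0.
  apply: big1 => b _; rewrite /gram gtn_eqF ?ltn_ord // ltnNge ltnW ?ltn_ord //.
  by rewrite mulr0.
under [in RHS]eq_bigr do rewrite big_ord_recr /= mulrDr.
rewrite big_split /= -addrA; congr (_ + _); rewrite add0r addr0 addrC.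
have -> : gram n n = - crossing w n by rewrite /gram eqxx.
rewrite epsE.
congr (_ + _); first by rewrite rmorphN /=; ring.
have -> : \sum_(a < n) f a * (f n * (gram a n)%:~R)
  = \sum_(a < n) (f n * ((Defs.col w a)%:R - (i : nat)%:R) * f a).
  apply: eq_bigr => a _; rewrite /gram ltn_eqF ?ltn_ord //= ci.
  by rewrite rmorphB /=; ring.
rewrite [RHS](bigID (fun a : 'I_n => Defs.col w a == 0%N)) /=.
rewrite [X in _ = _ + X](eq_bigl (fun a : 'I_n => Defs.col w a == 1%N)); last first.
  by move=> a; case: (Defs.col w a) (col_lt2 a) => [|[|]].
have colE (c : nat) : \sum_(a < n | Defs.col w a == c)
      f n * ((Defs.col w a)%:R - (i : nat)%:R) * f a
    = f n * (c%:R - (i : nat)%:R) * \sum_(a < n | Defs.col w a == c) f a.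
  by rewrite mulr_sumr; apply: eq_bigr => a /eqP ->.
rewrite !colE /cross /axis.
by case: (i) => [[|[|]]] //= ?; ring.
Qed.

End SeifertForm.

Section Loops.
Variables (w : word) (F : realFieldType).

Let N := size w.
Let n := size (loops w).
Let L (i : 'I_n) := nth (0%N, 0%N) (loops w) i.

Lemma mem_loops x : (x \in loops w) = is_loop w x.
Proof.
rewrite /loops mem_filter; case: (boolP (is_loop w x)) => //= lx.
case: x lx => p q /[dup] /is_loopP /= [pq qN _ _] _.
by apply/allpairsP; exists (p, q); rewrite !mem_iota /=; split=> //; lia.
Qed.

Lemma loop_is_loop i : is_loop w (L i).
Proof. by rewrite -mem_loops mem_nth. Qed.

(** The loop (p, q) goes up band p and down band q. *)
Definition loop_coord (Y : 'rV[F]_n) (m : nat) : F :=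
  \sum_(i < n) Y 0 i * (((L i).1 == m)%:R - ((L i).2 == m)%:R).

Lemma sum_loop_coord Y (G : nat -> F) :
  \sum_(a < N) loop_coord Y a * G a = \sum_(i < n) Y 0 i * (G (L i).1 - G (L i).2).
Proof.
under eq_bigr do rewrite mulr_suml.
rewrite exchange_big; apply: eq_bigr => i _ /=.
have [h1 h2 _ _] := is_loopP (loop_is_loop i).
have pick (p : nat) : (p < N)%N -> \sum_(a < N) (p == a)%:R * G a = G p.
  move=> pN; rewrite (bigD1 (Ordinal pN)) //= eqxx mul1r big1 ?addr0 // => a ap.
  suff -> : p == a = false by rewrite mul0r.
  by apply: contraNF ap => /eqP ap; apply/eqP/val_inj.
rewrite -(pick (L i).1) ?(ltn_trans h1) // -(pick (L i).2) // -sumrB mulr_sumr.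
by apply: eq_bigr => a _; ring.
Qed.

Definition seifert_form : 'M[F]_n :=
  map_mx intr (seifert_matrix w + (seifert_matrix w)^T).

Lemma seifert_energy (Y : 'rV[F]_n) :
  (Y *m seifert_form *m Y^T) 0 0
  = energy (0, 0) (map band_of w) (mkseq (loop_coord Y) N).
Proof.
have [_] := energy_gram (loop_coord Y) (leqnn N).
rewrite -[mkseq (nth _ _) _]/(mkseq _ N) -[N in mkseq (nth _ _) N](size_map band_of).
rewrite mkseq_nth => ->.
pose GL i j : F := (gram_loop w (L i) (L j))%:~R.
transitivity (\sum_(i < n) \sum_(j < n) Y 0 i * Y 0 j * GL i j); last first.
  rewrite (sum_loop_coord Y (fun a => \sum_(b < N) loop_coord Y b * (gram w a b)%:~R)).
  apply: eq_bigr => i _.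
  rewrite !(sum_loop_coord Y (fun b => (gram w _ b)%:~R)) -sumrB mulr_sumr.
  apply: eq_bigr => j _; rewrite /GL /gram_loop !(rmorphD, rmorphB) /=; ring.
have n2 : (2 : F) != 0 by rewrite pnatr_eq0.
apply: (mulfI n2).
transitivity (\sum_(i < n) \sum_(j < n) Y 0 i * Y 0 j * (GL i j + GL j i)); last first.
  under eq_bigr do under eq_bigr do rewrite mulrDr.
  under eq_bigr do rewrite big_split.
  rewrite big_split /= mulr_natl mulr2n; congr (_ + _).
  rewrite exchange_big; apply: eq_bigr => i _; apply: eq_bigr => j _.
  by rewrite [Y 0 j * _]mulrC.
rewrite mxE mulr_sumr exchange_big; apply: eq_bigr => j _ /=.
rewrite !mxE mulr_suml mulr_sumr; apply: eq_bigr => i _.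
rewrite !mxE /GL -rmorphD [gram_loop _ _ _ + _]addrC.
rewrite linking_gram ?loop_is_loop // rmorphM /=.
by rewrite -/(L i) -/(L j) [linking w _ _ + linking w _ _]addrC; ring.
Qed.

Lemma loop_coord_closed (Y : 'rV[F]_n) :
  endpoint (0, 0) (map band_of w) (mkseq (loop_coord Y) N) = (0, 0).
Proof.
have [+ _] := energy_gram (loop_coord Y) (leqnn N).
rewrite -[N in mkseq (nth _ _) N](size_map band_of) mkseq_nth => ->.
have h (c : nat) : \sum_(a < N | Defs.col w a == c) loop_coord Y a = 0.
  transitivity (\sum_(a < N) loop_coord Y a * (Defs.col w a == c)%:R).
    by rewrite big_mkcond; apply: eq_bigr => a _; case: eqP; rewrite ?mulr1 ?mulr0.
  rewrite (sum_loop_coord Y (fun a => (Defs.col w a == c)%:R)) big1 // => i _.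
  by have [_ _ -> _] := is_loopP (loop_is_loop i); rewrite subrr mulr0.
by rewrite !h.
Qed.

Lemma sum_loops (G : nat -> nat -> F) :
  \sum_(i < n) G (L i).1 (L i).2
  = \sum_(p < N) \sum_(q < N) (is_loop w (val p, val q))%:R * G p q.
Proof.
rewrite -(big_mkord xpredT
  (fun k => G (nth (0, 0)%N (loops w) k).1 (nth (0, 0)%N (loops w) k).2)).
rewrite -(big_nth (0, 0)%N xpredT (fun x => G x.1 x.2)) /loops big_filter.
rewrite big_mkcond big_allpairs_dep /=.
have iotaE : iota 0 (size w) = index_iota 0 N by rewrite /index_iota subn0.
rewrite iotaE big_mkord; apply: eq_bigr => p _; rewrite big_mkord.
by apply: eq_bigr => q _; case: ifP; rewrite ?mul1r ?mul0r.
Qed.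

Variable f : nat -> F.
Hypothesis closed : forall c, (c < 2)%N -> \sum_(a < N | Defs.col w a == c) f a = 0.

(** The coefficient of the loop that starts at band p in the decomposition of
    the closed sequence f into loops. *)
Definition height (p : nat) : F := \sum_(a < p.+1 | Defs.col w a == Defs.col w p) f a.

(** Either m has a unique successor in its column, or m is the last band of the
    column and its height is a full column sum, which vanishes. *)
Lemma sum_next_loop m : (m < N)%N ->
  \sum_(q < N) (is_loop w (m, val q))%:R * height m = height m.
Proof.
move=> mN; pose P q := [&& (m < q)%N, (q < N)%N & Defs.col w q == Defs.col w m].
have [[q Pq]|nP] := pselect (exists q, P q); last first.
  suff -> : height m = 0 by rewrite big1 // => q _; rewrite mulr0.
  rewrite -(closed (col_lt2 w m)) /height.
  rewrite (big_ord_widen_cond N (fun a => Defs.col w a == Defs.col w m) f mN).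
  apply: eq_bigl => a; case: eqP => //= ca; rewrite ltnS leqNgt.
  by apply/negP => ma; apply: nP; exists a; rewrite /P ma ltn_ord ca eqxx.
have ex : exists q, P q by exists q.
case: (ex_minnP ex) => q0 /and3P[mq0 q0N /eqP cq0] qmin.
have lq0 : is_loop w (m, q0).
  rewrite /is_loop /= mq0 q0N cq0 eqxx /=; apply/allP => r; rewrite mem_iota => hr.
  apply/negP => cr; have : P r by rewrite /P cr andbT; apply/andP; split; lia.
  by move/qmin; lia.
rewrite (bigD1 (Ordinal q0N)) //= lq0 mul1r big1 ?addr0 // => q1 ne.
suff -> : is_loop w (m, val q1) = false by rewrite mul0r.
apply/negP => /is_loopP /= [h1 h2 h3 h4].
have := qmin q1; rewrite /P h1 h2 h3 eqxx => /(_ isT) q01.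
apply: (h4 q0) => //; rewrite ltn_neqAle q01 andbT.
by apply: contraNneq ne => e; apply/eqP/val_inj.
Qed.

Lemma sum_prev_loop m : (m < N)%N ->
  \sum_(p < N) (is_loop w (val p, m))%:R * height p = height m - f m.
Proof.
move=> mN; pose P p := (p < m)%N && (Defs.col w p == Defs.col w m).
have hm : height m - f m = \sum_(a < m | Defs.col w a == Defs.col w m) f a.
  by rewrite /height big_mkcond big_ord_recr /= eqxx addrK -big_mkcond.
rewrite hm; have [[p Pp]|nP] := pselect (exists p, P p); last first.
  rewrite !big1 // => [a ca|p _].
    by case: nP; exists a; rewrite /P ltn_ord.
  suff -> : is_loop w (val p, m) = false by rewrite mul0r.
  apply/negP => /is_loopP /= [h1 h2 h3 h4]; apply: nP; exists p.
  by rewrite /P h1 h3 eqxx.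
have ex : exists p, P p by exists p.
have ub p' : P p' -> (p' <= m)%N by case/andP => /ltnW.
case: (ex_maxnP ex ub) => p0 /andP[p0m /eqP cp0] pmax.
have p0N : (p0 < N)%N by exact: ltn_trans p0m mN.
have lp0 : is_loop w (p0, m).
  rewrite /is_loop /= p0m mN cp0 eqxx /=; apply/allP => r; rewrite mem_iota => hr.
  apply/negP => cr; have : P r by rewrite /P cr andbT; lia.
  by move/pmax; lia.
rewrite (bigD1 (Ordinal p0N)) //= lp0 mul1r big1 ?addr0; last first.
  move=> p1 ne; suff -> : is_loop w (val p1, m) = false by rewrite mul0r.
  apply/negP => /is_loopP /= [h1 h2 h3 h4].
  have := pmax p1; rewrite /P h1 h3 eqxx => /(_ isT) p01.
  apply: (h4 p0) => //; last by rewrite cp0.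
  rewrite ltn_neqAle p01 andbT.
  by apply: contraNneq ne => e; apply/eqP/val_inj.
rewrite /height cp0 (big_ord_widen_cond m (fun a => Defs.col w a == Defs.col w m) f p0m).
apply: eq_bigl => a; case: eqP => //= ca; rewrite ltnS.
by apply: pmax; rewrite /P ltn_ord ca eqxx.
Qed.

(** Summation by parts: differences of consecutive heights give back f, so the
    loops span the closed sequences. *)
Lemma height_coord m : (m < N)%N ->
  loop_coord (\row_i height (L i).1) m = f m.
Proof.
move=> mN; rewrite /loop_coord.
under eq_bigr do rewrite mxE.
rewrite (sum_loops (fun p q => height p * ((p == m)%:R - (q == m)%:R))).
transitivity
  (\sum_(p < N) \sum_(q < N)
     (is_loop w (val p, val q))%:R * height p * (val p == m)%:R
   - \sum_(p < N) \sum_(q < N)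
       (is_loop w (val p, val q))%:R * height p * (val q == m)%:R).
  rewrite -sumrB; apply: eq_bigr => p _; rewrite -sumrB; apply: eq_bigr => q _ /=.
  ring.
have pick (G : nat -> F) : \sum_(p < N) G p * (val p == m)%:R = G m.
  rewrite (bigD1 (Ordinal mN)) //= eqxx mulr1 big1 ?addr0 // => p ne.
  suff -> : (val p == m) = false by rewrite mulr0.
  by apply: contraNF ne => /eqP e; apply/eqP/val_inj.
have -> : \sum_(p < N) \sum_(q < N)
    (is_loop w (val p, val q))%:R * height p * (val p == m)%:R
   = height m.
  under eq_bigr do rewrite -mulr_suml.
  rewrite (pick (fun p => \sum_(q < N) (is_loop w (p, val q))%:R * height p)).
  exact: sum_next_loop.
have -> : \sum_(p < N) \sum_(q < N)
    (is_loop w (val p, val q))%:R * height p * (val q == m)%:R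
   = height m - f m.
  rewrite -sum_prev_loop //; apply: eq_bigr => p _.
  by rewrite (pick (fun q => (is_loop w (val p, q))%:R * height p)).
by rewrite opprB addrC subrK.
Qed.

End Loops.

Section WordSign.
Variable w : word.
Let F : realFieldType := rat.
Let n := size (loops w).
Let N := size w.
Let L (i : 'I_n) := nth (0%N, 0%N) (loops w) i.

Lemma posdef_definite (tau : F) k :
  (exists2 W : 'M[F]_n, \rank W = k & posdef_on (tau *: seifert_form w F) W)
  <-> definite tau k (map band_of w).
Proof.
have formE (Y : 'rV[F]_n) : (Y *m (tau *: seifert_form w F) *m Y^T) 0 0
  = tau * energy (0, 0) (map band_of w) (mkseq (loop_coord Y) N).
  by rewrite -seifert_energy -scalemxAr -scalemxAl mxE.
split=> [[W rk pos]|[ws sz defw]].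
  subst k; pose B := row_base W.
  pose D (m : nat) : 'cV[F]_n := \col_i (((L i).1 == m)%:R - ((L i).2 == m)%:R).
  exists (mkseq (fun m => B *m D m) N); first by rewrite size_mkseq size_map.
  move=> c; have -> : evs c (mkseq (fun m => B *m D m) N) = mkseq (loop_coord (c *m B)) N.
    rewrite /evs /mkseq -map_comp; apply: eq_map => m /=.
    by rewrite /ev mulmxA mxE; apply: eq_bigr => i _; rewrite !mxE.
  rewrite loop_coord_closed -formE; split=> // c0; apply: pos.
    by rewrite (submx_trans (submxMl _ _)) // eq_row_base.
  by apply: contraNneq c0 => /eqP; rewrite mulmx_free_eq0 ?row_base_free.
rewrite size_map in sz.
pose f c m := ev c (nth 0 ws m).
pose H (p : nat) : 'cV[F]_k := \sum_(a < p.+1 | Defs.col w a == Defs.col w p) nth 0 ws a.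
pose B : 'M[F]_(k, n) := \matrix_(j, i) H (L i).1 j 0.
have fE c : evs c ws = mkseq (f c) N.
  by rewrite /N -sz -{1}(mkseq_nth 0 ws) /evs /mkseq -map_comp.
have BE c : c *m B = \row_i height w (f c) (L i).1.
  apply/rowP => i; rewrite !mxE /height /f -ev_sum -/(H _) /ev mxE.
  by apply: eq_bigr => j _; rewrite mxE.
have clos c : forall d, (d < 2)%N -> \sum_(a < N | Defs.col w a == d) f c a = 0.
  have [+ _] := defw c; have [+ _] := energy_gram (f c) (leqnn N).
  rewrite -[N in mkseq (nth _ _) N](size_map band_of) mkseq_nth fE => ->.
  by case=> h0 h1 [|[|]].
have coordE c : mkseq (loop_coord (c *m B)) N = evs c ws.
  rewrite fE; apply/eq_in_map => m; rewrite mem_iota add0n => /andP[_ mN].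
  by rewrite BE (height_coord (clos c)).
have pos (c : 'rV[F]_k) : c != 0 ->
    0 < ((c *m B) *m (tau *: seifert_form w F) *m (c *m B)^T) 0 0.
  by rewrite formE coordE => c0; have [_] := defw c; apply.
have freeB : row_free B.
  rewrite -kermx_eq0; apply/negP => /negP /rowV0Pn[c /sub_kermxP cB c0].
  by have := pos c c0; rewrite cB !mul0mx mxE ltxx.
exists <<B>>%MS; first by rewrite genmxE; exact/eqP.
move=> Y; rewrite genmxE => /submxP[c ->] cB0; apply: pos.
by apply: contraNneq cB0 => ->; rewrite mul0mx.
Qed.

Lemma pos_index_word (tau : F) :
  pos_index (tau *: seifert_form w F) = inertia tau (map band_of w).
Proof.
apply/eqP; rewrite eqn_leq; apply/andP; split.
  apply/bigmax_leqP => k /asboolP /posdef_definite; by move/inertia_ge.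
have := definite_inertia tau (map band_of w); move: (inertia _ _) => k.
move/posdef_definite => [W rk pos].
have kn : (k < n.+1)%N by rewrite ltnS -rk rank_leq_row.
apply: (@leq_bigmax_cond _ _ _ (Ordinal kn)); apply/asboolP.
by exists W.
Qed.

Lemma word_signE : word_sign w = signature_of F (map band_of w).
Proof.
rewrite /word_sign /signature /signature_of -!pos_index_word scale1r scaleN1r.
by [].
Qed.

End WordSign.

(** * Anticoncentration of random walks *)
Section Walk.
Variables (R : realType) (G : groupType) (mu : G -> R).
Hypothesis mu_prob : fin_probability mu.

Let mu_ge0 g : 0 <= mu g.
Proof. by case: mu_prob. Qed.

(** Measures with finite support are handled as lists of weighted atoms. *)
Lemma fsum_atoms (l : seq (G * R)) (f : G -> R) :
  \sum_(h \in [set: G]) f h * (\sum_(p <- l) p.2 * (p.1 == h)%:R)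
  = \sum_(p <- l) p.2 * f p.1.
Proof.
rewrite (fsbigE (undup (map fst l))) //=; last 2 first.
- exact: undup_uniq.
- move=> h _; rewrite mem_undup => hl; rewrite big1_seq ?mulr0 // => p /andP[_ pl].
  suff -> : (p.1 == h) = false by rewrite mulr0.
  by apply: contraNF hl => /eqP <-; exact: map_f.
rewrite big_mkcond /=.
under eq_bigr => h _ do rewrite in_setT mulr_sumr.
rewrite exchange_big /= big_seq [RHS]big_seq; apply: eq_bigr => p pl.
have pu : p.1 \in undup (map fst l) by rewrite mem_undup map_f.
rewrite (bigD1_seq p.1) ?undup_uniq //= eqxx mulr1 big1 ?addr0 1?mulrC // => h hp.
by rewrite eq_sym (negPf hp) !mulr0.
Qed.

Lemma steps_exist : exists2 s : seq G, uniq s & forall a, (a \in s) = (mu a != 0).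
Proof.
have [_ /finite_seqP[s sE] _] := mu_prob.
exists (undup s); first exact: undup_uniq.
move=> a; rewrite mem_undup.
have e : (mu a != 0) <-> a \in s by rewrite -[is_true (mu a != 0)]/(supp mu a) sE.
by apply/idP/idP => /e.
Qed.

Definition steps : seq G := s2val (cid2 steps_exist).

Lemma steps_uniq : uniq steps.
Proof. by rewrite /steps; case: cid2. Qed.

Lemma mem_steps a : (a \in steps) = (mu a != 0).
Proof. by rewrite /steps; case: cid2. Qed.

Lemma step_decomposition g : mu g = \sum_(a <- steps) mu a * (a == g)%:R.
Proof.
have [gs|gs] := boolP (g \in steps).
  rewrite (bigD1_seq g) ?steps_uniq //= eqxx mulr1 big1 ?addr0 // => h hg.
  by rewrite (negPf hg) mulr0.
rewrite big1_seq; first by move: gs; rewrite mem_steps negbK => /eqP.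
move=> a /andP[_ as_]; suff -> : (a == g) = false by rewrite mulr0.
by apply: contraNF gs => /eqP <-.
Qed.

Lemma sum_steps : \sum_(a <- steps) mu a = 1.
Proof.
have [_ _ <-] := mu_prob; rewrite /measure_of.
rewrite (fsbigE steps) ?steps_uniq //=; last first.
  by move=> i _; rewrite mem_steps negbK => /eqP.
by rewrite [RHS]big_mkcond; apply: eq_bigr => a _; rewrite in_setT.
Qed.

(** The expected value of f at time k, where the recursion splits off the
    leftmost of the k factors of the position. *)
Fixpoint expect (k : nat) (f : G -> R) : R :=
  if k is k'.+1 then \sum_(a <- steps) mu a * expect k' (fun g => f (a * g)%g)
  else f 1%g.

Lemma expect_atoms k : exists l : seq (G * R),
  (forall g, convolution_pow mu k g = \sum_(p <- l) p.2 * (p.1 == g)%:R) /\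
  (forall f, expect k f = \sum_(p <- l) p.2 * f p.1).
Proof.
elim: k => [|k [l [lmu lE]]].
  exists [:: (1%g, 1)]; split=> [g|f]; rewrite big_seq1 /= mul1r //.
  by rewrite eq_sym.
exists [seq ((a * p.1)%g, mu a * p.2) | a <- steps, p <- l]; split=> [g|f]; last first.
  rewrite big_allpairs_dep /=; apply: eq_bigr => a _.
  by rewrite lE mulr_sumr; apply: eq_bigr => p _; rewrite mulrA.
rewrite big_allpairs_dep exchange_big /= /convolution.
under eq_fsbigr => h _ do rewrite -/(convolution_pow mu k) lmu.
rewrite (fsum_atoms l (fun h => mu (g * h^-1)%g)); apply: eq_bigr => p _.
rewrite step_decomposition mulr_sumr; apply: eq_bigr => a _.
have -> : (a == g * p.1^-1)%g = (a * p.1 == g)%g.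
  by apply/eqP/eqP => [->|<-]; rewrite ?mulgVK ?mulgK.
by rewrite mulrCA mulrA.
Qed.

Lemma measure_expect k (S : set G) :
  measure_of (convolution_pow mu k) S = expect k (fun g => (g \in S)%:R).
Proof.
have [l [lmu lE]] := expect_atoms k; rewrite lE -(fsum_atoms l (fun g => (g \in S)%:R)).
rewrite /measure_of fsbig_mkcond.
apply: eq_fsbigr => g _; rewrite /patch lmu.
by case: ifP; rewrite ?mul1r ?mul0r.
Qed.

Lemma expect_eq k f f' : f =1 f' -> expect k f = expect k f'.
Proof. by move=> /funext ->. Qed.

Lemma expect_le k f f' : (forall g, f g <= f' g) -> expect k f <= expect k f'.
Proof.
elim: k f f' => [|k ih] f f' h /=; first exact: h.
by apply: ler_sum => a _; rewrite ler_wpM2l // ih.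
Qed.

Lemma expectD k f f' : expect k (fun g => f g + f' g) = expect k f + expect k f'.
Proof.
elim: k f f' => //= k ih f f'.
by rewrite -big_split; apply: eq_bigr => a _; rewrite ih mulrDr.
Qed.

Lemma expectZ k c f : expect k (fun g => c * f g) = c * expect k f.
Proof.
elim: k f => //= k ih f.
by rewrite mulr_sumr; apply: eq_bigr => a _; rewrite ih mulrCA.
Qed.

Lemma expect_cst k c : expect k (fun=> c) = c.
Proof.
elim: k => //= k ->.
by rewrite -mulr_suml sum_steps mul1r.
Qed.

Lemma expect_sum k (I : Type) (r : seq I) (P : pred I) (f : I -> G -> R) :
  expect k (fun g => \sum_(i <- r | P i) f i g) = \sum_(i <- r | P i) expect k (f i).
Proof.
elim: r => [|i r ih].
  by rewrite big_nil -[RHS](expect_cst k); apply: expect_eq => g; rewrite big_nil.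
rewrite big_cons -ih; case: ifP => Pi.
  by rewrite -expectD; apply: expect_eq => g; rewrite big_cons Pi.
by apply: expect_eq => g; rewrite big_cons Pi.
Qed.

Lemma expect_ge0 k f : (forall g, 0 <= f g) -> 0 <= expect k f.
Proof. by move=> f0; rewrite -(expect_cst k 0); exact: expect_le. Qed.

Lemma expectDn n k f :
  expect (n + k) f = expect n (fun g => expect k (fun h => f (g * h)%g)).
Proof.
elim: n f => [|n ih] f /=; first by apply: expect_eq => h; rewrite mul1g.
apply: eq_bigr => a _; rewrite ih; congr (_ * _); apply: expect_eq => g.
by apply: expect_eq => h; rewrite mulgA.
Qed.

(** Positions after n steps with values in s and s^-1: powers of s with exponents
    of the parity of n, all reached at the same time n. *)
Definition zigzag (s : G) n i : G := (s ^+ i * s ^- (n - i))%g.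

Lemma expect_ge_zigzag n p s D : 0 < p -> p <= mu s -> p <= mu s^-1%g ->
  (s != s^-1)%g -> (forall g, 0 <= D g) ->
  p ^+ n * \sum_(i < n.+1) D (zigzag s n i) <= expect n D.
Proof.
move=> pp ps psV sV; have p0 := ltW pp; elim: n D => [|n ih] D D0 /=.
  by rewrite expr0 mul1r big_ord1 /zigzag /= expg0 invg1 mul1g.
have ss : s \in steps by rewrite mem_steps gt_eqF // (lt_le_trans pp).
have sVs : (s^-1)%g \in steps by rewrite mem_steps gt_eqF // (lt_le_trans pp).
rewrite (bigD1_seq s) ?steps_uniq //= -[X in _ <= _ + X]big_filter.
rewrite (bigD1_seq s^-1%g) ?filter_uniq ?steps_uniq //=; last first.
  by rewrite mem_filter eq_sym sV.
rewrite addrA.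
apply: ler_wpDr.
  by apply: sumr_ge0 => a _; rewrite mulr_ge0 // expect_ge0.
have h1 := ih (fun g => D (s * g)%g) (fun g => D0 _).
have h2 := ih (fun g => D (s^-1 * g)%g) (fun g => D0 _).
have pn : 0 <= p ^+ n by exact: exprn_ge0.
rewrite big_ord_recl mulrDr [X in X <= _]addrC exprS; apply: lerD.
  rewrite -mulrA; apply: ler_pM => //.
    by rewrite mulr_ge0 // sumr_ge0.
  apply: le_trans h1; rewrite ler_wpM2l //; apply: ler_sum => i _.
  by rewrite /zigzag /= /bump /= add1n subSS expgS mulgA.
rewrite -mulrA; apply: ler_pM => //; first by rewrite mulr_ge0.
apply: le_trans h2; rewrite ler_wpM2l // big_ord_recl.
rewrite /zigzag /= expg0 !mul1g !subn0 expgSr invgM.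
by rewrite lerDl sumr_ge0.
Qed.

(** A x is an event attached to a target x, and moving the walk amounts to moving
    the target. *)
Section Anticoncentration.
Variables (X : Type) (op : G -> X -> X) (D : X -> Prop) (A : X -> G -> bool).
Hypothesis opD : forall g x, D x -> D (op g x).
Hypothesis A_shift : forall x a g, A x (a * g)%g = A (op a^-1%g x) g.
Variables (p : R) (s : X -> G).
Hypothesis p_gt0 : 0 < p.
Hypothesis s_step : forall x,
  [/\ p <= mu (s x), p <= mu (s x)^-1%g & (s x != (s x)^-1)%g].

Definition prob k x : R := expect k (fun g => (A x g)%:R).

Definition target n x i : X := op (zigzag (s x) n i)^-1%g x.

(** With S the number of true values, this is S <= 1 + S (S - 1). *)
Lemma sum_indicator n (b : 'I_n -> bool) :
  \sum_(i < n) (b i)%:R <= 1 + \sum_(i < n) \sum_(j < n | j != i) (b i && b j)%:R :> R.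
Proof.
set S := (X in X <= _).
have -> : \sum_(i < n) \sum_(j < n | j != i) (b i && b j)%:R = S ^+ 2 - S :> R.
  rewrite expr2 {1}/S mulr_suml -sumrB; apply: eq_bigr => i _.
  rewrite {1}/S [in RHS](bigD1 i) //= mulrDr -natrM mulnb andbb addrAC subrr add0r mulr_sumr.
  by apply: eq_bigr => j _; rewrite -natrM mulnb.
have := sqr_ge0 (S - 1); rewrite sqrrB1 => h; lra.
Qed.

(** The deficit M - prob k is nonnegative on D, and prob (n + k) x averages
    prob k over translates of x. Keeping only the n + 1 zigzag translates, whose
    events nearly are disjoint, bounds the average deficit from below. *)
Lemma prob_step n k (M eta : R) : 0 <= eta ->
  (forall x, D x -> prob k x <= M) ->
  (forall x (i j : 'I_n.+1), D x -> i != j ->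
     expect k (fun g => (A (target n x i) g && A (target n x j) g)%:R) <= eta) ->
  forall x, D x ->
  prob (n + k) x <= M - p ^+ n * (n.+1%:R * M - 1 - n.+1%:R ^+ 2 * eta).
Proof.
move=> eta0 hM heta x Dx; have [ps psV sV] := s_step x.
have E1 : prob (n + k) x = expect n (fun g => prob k (op g^-1%g x)).
  rewrite /prob expectDn; apply: expect_eq => g; apply: expect_eq => h.
  by rewrite A_shift.
have := @expect_ge_zigzag n p (s x) (fun g => M - prob k (op g^-1%g x))
  p_gt0 ps psV sV.
have -> : expect n (fun g => M - prob k (op g^-1%g x)) = M - prob (n + k) x.
  rewrite (expectD n (fun=> M) (fun g => - prob k (op g^-1%g x))) expect_cst E1.
  congr (_ + _); rewrite -mulN1r -expectZ; apply: expect_eq => g.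
  by rewrite mulN1r.
move=> /(_ _)/wrap[g|]; first by rewrite subr_ge0; exact/hM/opD.
move=> h; suff h2 : n.+1%:R * M - 1 - n.+1%:R ^+ 2 * eta
    <= \sum_(i < n.+1) (M - prob k (target n x i)).
  have := ler_wpM2l (exprn_ge0 n (ltW p_gt0)) h2 => h3.
  have := le_trans h3 h; lra.
rewrite sumrB sumr_const card_ord -(mulr_natl M) -addrA lerD2l -opprD lerN2.
rewrite /prob -expect_sum.
apply: le_trans (expect_le _ (fun g =>
  sum_indicator (fun i : 'I_n.+1 => A (target n x i) g))) _.
rewrite (expectD k (fun=> 1)) expect_cst lerD2l expect_sum.
apply: (@le_trans _ _ (\sum_(i < n.+1) \sum_(j < n.+1 | j != i) eta)).
  apply: ler_sum => i _; rewrite expect_sum; apply: ler_sum => j ji.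
  by apply: heta => //; rewrite eq_sym.
apply: (@le_trans _ _ (\sum_(i < n.+1) \sum_(j < n.+1) eta)).
  apply: ler_sum => i _; rewrite [X in _ <= X](bigID (fun j => j != i)) /=.
  by rewrite lerDl sumr_ge0.
by rewrite !sumr_const card_ord -(mulr_natl eta) -(mulr_natl (_ * eta)) mulrA -expr2.
Qed.

Hypothesis overlap : forall n (eta : R), 0 < eta -> exists K, forall k, (K <= k)%N ->
  forall x (i j : 'I_n.+1), D x -> i != j ->
     expect k (fun g => (A (target n x i) g && A (target n x j) g)%:R) <= eta.

Lemma prob_le1 k x : prob k x <= 1.
Proof.
rewrite -(expect_cst k 1); apply: expect_le => g.
by case: (A x g).
Qed.

(** With n + 1 >= 2 / e and overlaps of total size at most 1 / 2, a bound M >= e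
    satisfies (n + 1) M - 1 - 1 / 2 >= 1 / 2, hence is lowered by p^n / 2. *)
Lemma anticoncentration (e : R) : 0 < e ->
  exists K, forall k, (K <= k)%N -> forall x, D x -> prob k x <= e.
Proof.
move=> e0; pose n := Num.truncn (2 / e); pose m : R := n.+1%:R.
have m0 : 0 < m by exact: ltr0Sn.
have mP : 2 <= m * e.
  by rewrite -ler_pdivrMr // ltW // /m truncnS_gt.
pose eta : R := (2 * m ^+ 2)^-1.
have eta0 : 0 < eta by rewrite invr_gt0 mulr_gt0 // exprn_gt0.
have mmeta : m ^+ 2 * eta = 2^-1.
  by rewrite /eta invfM mulrCA divff ?mulr1 // expf_neq0 // gt_eqF.
have [K0 hK0] := overlap n eta0.
pose d := p ^+ n / 2; have d0 : 0 < d by rewrite divr_gt0 // exprn_gt0.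
have claim j : exists K, forall k, (K <= k)%N -> forall x, D x ->
    prob k x <= Num.max e (1 - j%:R * d).
  elim: j => [|j [K hK]].
    exists 0%N => k _ x _; rewrite mul0r subr0 le_max prob_le1 orbT //.
  exists (n + maxn K K0)%N => k kK x Dx.
  have -> : k = (n + (k - n))%N by lia.
  have k1 : (K <= k - n)%N by lia.
  have k2 : (K0 <= k - n)%N by lia.
  apply: le_trans (prob_step (ltW eta0) (hK _ k1) (hK0 _ k2) Dx) _.
  rewrite -/m mmeta; set M := Num.max _ _.
  have eM : e <= M by rewrite le_max lexx.
  have mM : 2 <= m * M by apply: le_trans mP _; rewrite ler_pM2l.
  have : p ^+ n * 2^-1 <= p ^+ n * (m * M - 1 - 2^-1).
    by rewrite ler_pM2l ?exprn_gt0 //; lra.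
  rewrite -/d => h; apply: (@le_trans _ _ (M - d)); first by rewrite lerD2l lerN2.
  rewrite /M lerBlDr ge_max -natr1 mulrDl mul1r; apply/andP; split.
    by rewrite -lerBlDr le_max lerBlDr lerDl (ltW d0).
  by rewrite -lerBlDr le_max; apply/orP; right; lra.
have [K hK] := claim (Num.truncn (d^-1)).+1; exists K => k kK x Dx.
apply: le_trans (hK k kK x Dx) _; rewrite ge_max lexx /=.
suff : 1 <= (Num.truncn d^-1).+1%:R * d by move=> h; lra.
by rewrite -ler_pdivrMr // mul1r ltW // truncnS_gt.
Qed.

End Anticoncentration.

End Walk.

(** * The action of the braid group on the plane *)
Lemma twist_inv g u : twist (band_inv g) (twist g u) = u.
Proof.
case: g u => [[g1 g2] e] [u1 u2]; rewrite /twist /band_inv /cross /=.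
by case: e; rewrite /eps /=; congr pair; ring.
Qed.

Lemma cross_twist g u v : cross (twist g u) (twist g v) = cross u v.
Proof.
case: g u v => [[g1 g2] e] [u1 u2] [v1 v2]; rewrite /twist /cross /=.
by case: e; rewrite /eps /=; ring.
Qed.

Lemma act_word_cat w w' u : act_word (w ++ w') u = act_word w (act_word w' u).
Proof. by rewrite /act_word foldr_cat. Qed.

Lemma act_word_braid_eq w w' : braid_eq w w' -> act_word w =1 act_word w'.
Proof.
elim=> // {w w'} [u v _ h x|u v w _ h1 _ h2 x|u v l x|u v a b x].
- by rewrite h.
- by rewrite h1.
- rewrite !act_word_cat /=; congr (act_word u _).
  have := twist_inv (band_of (letter_inv l)) (act_word v x).
  by rewrite /band_inv /= negbK.
- rewrite !act_word_cat; congr act_word; move: (act_word v x) => -[x1 x2].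
  by rewrite /= /twist /cross /axis /= /eps; congr pair; ring.
Qed.

Definition act (g : B3) : plane int -> plane int := act_word (word_of_braid g).

Lemma act_of_word w : act (braid_of_word w) =1 act_word w.
Proof. exact/act_word_braid_eq/word_of_braid_pi. Qed.

Lemma actM g h u : act (g * h)%g u = act g (act h u).
Proof.
rewrite -[g in LHS]word_of_braidK -[h in LHS]word_of_braidK -braid_of_word_cat.
by rewrite act_of_word act_word_cat.
Qed.

Lemma act1 u : act 1%g u = u.
Proof. exact: (act_of_word [::]). Qed.

Lemma actK g u : act g (act g^-1%g u) = u.
Proof. by rewrite -actM mulgV act1. Qed.

Lemma actVK g u : act g^-1%g (act g u) = u.
Proof. by rewrite -actM mulVg act1. Qed.

Lemma cross_act g u v : cross (act g u) (act g v) = cross u v.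
Proof. by rewrite /act; elim: (word_of_braid g) => //= l w ih; rewrite cross_twist. Qed.

Lemma act_eq0 g u : act g u = (0, 0) -> u = (0, 0).
Proof.
have act0 w : act_word w (0, 0) = (0, 0).
  elim: w => //= l w ->; rewrite /twist /cross /=; congr pair; ring.
by move=> h; rewrite -(actVK g u) h; exact: act0.
Qed.

(** The t-th power of the transvection of sigma_i, for an integer t. *)
Definition shear (i : 'I_2) (t : int) (u : plane int) : plane int :=
  (u.1 + t * cross (axis i) u * (axis i).1, u.2 + t * cross (axis i) u * (axis i).2).

Lemma shearD i t t' u : shear i t (shear i t' u) = shear i (t + t') u.
Proof. by rewrite /shear /cross /=; congr pair; ring. Qed.

Lemma act_sigma i u : act (sigma i) u = shear i 1 u.
Proof. by rewrite act_of_word. Qed.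

Lemma act_sigmaX i m u : act (sigma i ^+ m)%g u = shear i m%:Z u.
Proof.
elim: m => [|m ih]; first by rewrite expg0 act1 /shear !mul0r !addr0 -surjective_pairing.
by rewrite expgS actM ih act_sigma shearD -PoszD add1n.
Qed.

Lemma act_sigmaXV i m u : act (sigma i ^- m)%g u = shear i (- m%:Z) u.
Proof.
rewrite -[RHS](actVK (sigma i ^+ m)%g) act_sigmaX shearD subrr.
by congr act; rewrite /shear !mul0r !addr0 -surjective_pairing.
Qed.

Lemma act_zigzag i n m u : (m <= n)%N ->
  act (zigzag (sigma i) n m)^-1%g u = shear i (n%:Z - (2 * m)%:Z) u.
Proof.
move=> mn; rewrite /zigzag invgM invgK actM act_sigmaX act_sigmaXV shearD.
by congr shear; lia.
Qed.

Lemma cross_shear i t t' u :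
  cross (shear i t u) (shear i t' u) = (t - t') * cross (axis i) u ^+ 2.
Proof. by rewrite /shear /cross /=; ring. Qed.

Lemma act_sigma_neq i : (sigma i != (sigma i)^-1)%g.
Proof.
apply/eqP => e.
have := congr1 (fun g => act g (axis (1 - i))) e.
rewrite /= act_sigma -[(sigma i)^-1%g]/(sigma i ^- 1)%g act_sigmaXV.
by case: i {e} => [[|[|]]] //= ?; rewrite /shear /axis /cross.
Qed.

Definition mover (u : plane int) : 'I_2 := if u.2 != 0 then 0 else 1.

Lemma moverP u : u <> (0, 0) -> cross (axis (mover u)) u != 0.
Proof.
case: u => u1 u2 u0; rewrite /mover /=; case: ifPn => h; rewrite /cross /axis /=.
  by move: h; rewrite /=; lia.
apply/eqP => h'; apply: u0; congr pair; last by apply/eqP; move: h; rewrite negbK.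
by lia.
Qed.

(** * Strips are rarely visited *)
Section BraidWalk.
Variables (R : realType) (mu : B3 -> R).
Hypothesis mu_prob : fin_probability mu.
Hypothesis mu_sigma : forall i : 'I_2, mu (sigma i) != 0 /\ mu ((sigma i)^-1)%g != 0.

(* The scopes matter: 1%g would be the unit of the additive group 'I_2, that
   is 0. *)
Let p : R := Num.min (Num.min (mu (sigma 0)) (mu (sigma 0%R)^-1%g))
                     (Num.min (mu (sigma 1)) (mu (sigma 1%R)^-1%g)).

Let mu_gt0 g : mu g != 0 -> 0 < mu g.
Proof. by move=> h; rewrite lt0r h; case: mu_prob => ->. Qed.

Let p_gt0 : 0 < p.
Proof.
have [[a b] [c d]] := (mu_sigma 0, mu_sigma 1).
by rewrite /p !lt_min !mu_gt0.
Qed.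

Let s_step (x : plane int) (s := sigma (mover x)) :
  [/\ p <= mu s, p <= mu s^-1%g & (s != s^-1)%g].
Proof.
have : p <= p by exact: lexx.
rewrite {2}/p !le_min => /andP[/andP[h1 h2] /andP[h3 h4]].
split; last exact: act_sigma_neq.
all: by rewrite /s /mover; case: ifP.
Qed.

Let nonzero (x : plane int) : Prop := x <> (0, 0).

Let act_nonzero g x : nonzero x -> nonzero (act g x).
Proof. by move=> x0 /act_eq0. Qed.

(** Distinct points of an affine line that avoids the origin are independent. *)
Lemma cross_targets n x (i j : 'I_n.+1) : nonzero x -> i != j ->
  cross (target act (fun x => sigma (mover x)) n x i)
        (target act (fun x => sigma (mover x)) n x j) != 0.
Proof.
move=> x0 ij; rewrite /target !act_zigzag ?leq_ord // cross_shear.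
rewrite mulf_neq0 //; last by rewrite expf_neq0 // moverP.
move: ij; rewrite -val_eqE /=; lia.
Qed.

Variable e : plane int.
Hypothesis e0 : nonzero e.

Definition at_point x g := act g e == x.

Lemma point_prob (d : R) : 0 < d -> exists K, forall k, (K <= k)%N ->
  forall x, nonzero x -> expect mu_prob k (fun g => (at_point x g)%:R) <= d.
Proof.
apply: (@anticoncentration _ _ _ mu_prob _ act nonzero at_point act_nonzero
  _ _ _ p_gt0 s_step).
- move=> x a g; rewrite /at_point actM.
  by apply/eqP/eqP => [<-|->]; rewrite ?actVK ?actK.
move=> n eta eta0; exists 0%N => k _ x i j x0 ij.
rewrite (@expect_eq _ _ _ mu_prob k _ (fun=> 0)); first by rewrite expect_cst ltW.
move=> g; case: (boolP (_ && _)) => // /andP[/eqP h1 /eqP h2].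
have := cross_targets x0 ij; rewrite -h1 -h2.
by rewrite /cross mulrC subrr eqxx.
Qed.

Definition in_strip x g := `|cross (act g e) x| <= 2.

Lemma cross_inj (v v' y y' : plane int) : cross y y' != 0 ->
  cross v y = cross v' y -> cross v y' = cross v' y' -> v = v'.
Proof.
case: v v' y y' => [v1 v2] [v1' v2'] [y1 y2] [z1 z2]; rewrite /cross /= => h h1 h2.
have e1 : (v1 - v1') * (y2 * z1 - y1 * z2) = 0.
  transitivity (y1 * ((v2 * z1 - v1 * z2) - (v2' * z1 - v1' * z2))
    - z1 * ((v2 * y1 - v1 * y2) - (v2' * y1 - v1' * y2))); first by ring.
  by rewrite h1 h2 !subrr !mulr0 subrr.
have e2 : (v2 - v2') * (y2 * z1 - y1 * z2) = 0.
  transitivity (y2 * ((v2 * z1 - v1 * z2) - (v2' * z1 - v1' * z2))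
    - z2 * ((v2 * y1 - v1 * y2) - (v2' * y1 - v1' * y2))); first by ring.
  by rewrite h1 h2 !subrr !mulr0 subrr.
move/eqP: e1; rewrite mulf_eq0 (negPf h) orbF subr_eq0 => /eqP ->.
by move/eqP: e2; rewrite mulf_eq0 (negPf h) orbF subr_eq0 => /eqP ->.
Qed.

Definition small : seq int := [:: -2; -1; 0; 1; 2].

Lemma mem_small (z : int) : (z \in small) = (`|z| <= 2).
Proof. rewrite !inE; lia. Qed.

(** Two strips in independent directions meet in at most 5 * 5 points of Z^2, one
    for each pair of values of the two linear forms. *)
Lemma strip_prob (d : R) : 0 < d -> exists K, forall k, (K <= k)%N ->
  forall x, nonzero x -> expect mu_prob k (fun g => (in_strip x g)%:R) <= d.
Proof.
apply: (@anticoncentration _ _ _ mu_prob _ act nonzero in_strip act_nonzero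
  _ _ _ p_gt0 s_step).
- move=> x a g; rewrite /in_strip actM.
  by rewrite -(cross_act a^-1%g (act a _)) actVK.
move=> n eta eta0.
have [|K hK] := @point_prob (eta / 25); first by rewrite divr_gt0.
exists K => k kK x i j x0 ij.
set y := target _ _ _ _ i; set y' := target _ _ _ _ j.
have yy' : cross y y' != 0 by exact: cross_targets.
pose f (c c' : int) (g : B3) : R :=
  ((cross (act g e) y == c) && (cross (act g e) y' == c'))%:R.
have fE c c' : expect mu_prob k (f c c') <= eta / 25.
  have [[v [v0 [vc vc']]]|nv] :=
      pselect (exists v, nonzero v /\ cross v y = c /\ cross v y' = c').
    apply: le_trans (hK k kK v v0); apply: expect_le => g.
    rewrite /f /at_point; case: (boolP (_ && _)) => [/andP[/eqP h1 /eqP h2]|_];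
      last exact: ler0n.
    by rewrite (cross_inj yy' (v := act g e) (v' := v)) ?eqxx // ?h1 ?h2.
  rewrite (@expect_eq _ _ _ mu_prob k _ (fun=> 0)).
    by rewrite expect_cst divr_ge0 // ltW.
  move=> g; rewrite /f; case: (boolP (_ && _)) => // /andP[/eqP h1 /eqP h2].
  by case: nv; exists (act g e); split; first exact: act_nonzero.
apply: (@le_trans _ _ (\sum_(c <- small) \sum_(c' <- small) expect mu_prob k (f c c'))).
  rewrite (eq_bigr (fun c => expect mu_prob k (fun g =>
    \sum_(c' <- small) f c c' g))); last first.
    by move=> c _; rewrite expect_sum.
  rewrite -expect_sum; apply: expect_le => g.
  have f0 c c' : 0 <= f c c' g by exact: ler0n.
  rewrite /in_strip -!mem_small; case: (boolP (_ && _)) => [/andP[h1 h2]|_]; last first.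
    by apply: sumr_ge0 => c _; apply: sumr_ge0 => c' _.
  rewrite (big_rem _ h1) (big_rem _ h2) /=.
  rewrite {1}/f !eqxx /= -addrA lerDl addr_ge0 ?sumr_ge0 // => c _; exact: sumr_ge0.
apply: (@le_trans _ _ (\sum_(c <- small) \sum_(c' <- small) eta / 25)).
  by apply: ler_sum => c _; apply: ler_sum => c' _.
rewrite /small !big_cons !big_nil; lra.
Qed.

End BraidWalk.

(** * Signatures of powers of products of two conjugates of generators *)
Lemma sign_quasipositive (b : B3) (i j : 'I_2) n :
  2 < `|cross (act b (axis i)) (axis j)| ->
  sign ((b * sigma i * b^-1 * sigma j) ^+ n)%g = 0.
Proof.
move=> hb; pose w := word_of_braid b.
pose W := w ++ [:: (i, true)] ++ word_inv w ++ [:: (j, true)].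
have WE : braid_of_word (repeat_word n W) = ((b * sigma i * b^-1 * sigma j) ^+ n)%g.
  elim: n => [|n ih] //=.
  rewrite /repeat_word /= braid_of_word_cat -/(repeat_word n W) ih expgS; congr (_ * _)%g.
  by rewrite /W !braid_of_word_cat word_of_braidK !mulgA.
rewrite -WE /sign word_signE -(sig_word_power rat n hb).
exact/sig_braid_eq/word_of_braid_pi.
Qed.

Lemma axis_neq0 i : axis i <> (0, 0).
Proof. by rewrite /axis; case: ifP. Qed.

Lemma transient_strips (R : realType) (mu : B3 -> R) (S : set B3) :
  fin_probability mu ->
  (forall i : 'I_2, mu (sigma i) != 0 /\ mu ((sigma i)^-1)%g != 0) ->
  (forall g, S g -> exists i j, in_strip (axis i) (axis j) g) ->
  transient mu S.
Proof.
move=> mu_prob mu_sigma subS.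
pose strip (i j : 'I_2) := in_strip (axis i) (axis j).
have bound k : measure_of (convolution_pow mu k) S
    <= \sum_i \sum_j expect mu_prob k (fun g => (strip i j g)%:R).
  rewrite (measure_expect mu_prob).
  under eq_bigr do rewrite -expect_sum.
  rewrite -expect_sum; apply: expect_le => g.
  case: (boolP (g \in S)) => [|_]; last by apply: sumr_ge0 => i _; apply: sumr_ge0.
  rewrite inE => /subS [i [j sij]].
  rewrite (bigD1 i) //= (bigD1 j) //= /strip sij -addrA lerDl.
  by rewrite addr_ge0 ?sumr_ge0 // => l _; exact: sumr_ge0.
apply/cvgrPdist_le => d d0.
have d4 : 0 < d / 4 by rewrite divr_gt0.
have sp i := strip_prob mu_prob mu_sigma (@axis_neq0 i) d4.
have [K0 h0] := sp 0; have [K1 h1] := sp 1.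
near=> k.
have k0 : (K0 <= k)%N by near: k; exact: nbhs_infty_ge.
have k1 : (K1 <= k)%N by near: k; exact: nbhs_infty_ge.
rewrite sub0r normrN ger0_norm; last first.
  by rewrite (measure_expect mu_prob) expect_ge0.
apply: le_trans (bound k) _; rewrite !big_ord_recl !big_ord0 /=.
have := (h0 k k0 _ (@axis_neq0 0), h0 k k0 _ (@axis_neq0 1),
         h1 k k1 _ (@axis_neq0 0), h1 k k1 _ (@axis_neq0 1)).
have -> : lift ord0 ord0 = 1 :> 'I_2 by exact/val_inj.
rewrite -[ord0]/(0 : 'I_2) /strip => -[[[a1 a2] a3] a4]; lra.
Unshelve. all: by end_near.
Qed.

Theorem proposition1 (R : realType) (mu : B3 -> R)
  (mu_prob : fin_probability mu)
  (mu_nondeg : nondegenerate_prob mu)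
  (mu_sigma : forall i : 'I_2,
     mu (sigma i) != 0 /\ mu ((sigma i)^-1)%g != 0) :
  transient mu
    [set beta : B3 | exists (n : nat) (i j : 'I_2),
       sign ((beta * sigma i * beta^-1 * sigma j) ^+ n)%g != 0].
Proof.
apply: transient_strips => // g [n [i [j]]]; move=> sg; exists i, j.
rewrite /in_strip leNgt; apply: contraNN sg => h.
by rewrite sign_quasipositive.
Qed.
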